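(* The measures $\mu$ and $\nu$ induce a ring isomorphism $$\Theta(G) \cong \mathbf{Z}_{(2)} \times \mathbf{Q}.$$ That is, the ring homomorphism $\Theta(G) \to \mathbf{Q} \times \mathbf{Q}$ given by $[f] \mapsto (\mu(f),\nu(f))$ is injective with image $\mathbf{Z}_{(2)} \times \mathbf{Q}$, where $\mathbf{Z}_{(2)} \subset \mathbf{Q}$ is the ring of rational numbers with odd denominator.
   Context: Let $\mathfrak{X}$ be a Cantor space (a topological space homeomorphic to the Cantor set), and let $G$ be the group of all self-homeomorphisms of $\mathfrak{X}$. For a subset $\mathfrak{A} \subset \mathfrak{X}$ let $G\{\mathfrak{A}\}=\{g \in G : g\mathfrak{A}=\mathfrak{A}\}$. Let $\mathscr{E}$ be the collection of all subgroups of $G$ of the form $G\{\mathfrak{A}_1\} \cap \cdots \cap G\{\mathfrak{A}_n\}$ with $\mathfrak{A}_1,\ldots,\mathfrak{A}_n$ clopen subsets of $\mathfrak{X}$. Topologize $G$ by taking $\mathscr{E}$ as a neighborhood basis of the identity. A ''$G$-set'' is a set with a smooth $G$-action, i.e., all point stabilizers are open subgroups. A $G$-set is finitary if it has finitely many orbits. $\mathbf{S}(G)$ is the category of finitary $G$-sets and $G$-equivariant maps (it is closed under fiber products). $\mathbf{1}$ is the one-point $G$-set. A measure for $G$ valued in a commutative ring $k$ is a rule $\mu$ assigning to each map $f\colon X \to Y$ in $\mathbf{S}(G)$, with $Y$ transitive, a value $\mu(f) \in k$ such that: (a) if $f$ is an isomorphism then $\mu(f)=1$; (b) if $X=X_1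 \amalg X_2$ is a decomposition into $G$-sets and $f_i=f|_{X_i}$, then $\mu(f)=\mu(f_1)+\mu(f_2)$; (c) if $g \colon Y \to Z$ is a map of transitive $G$-sets then $\mu(g \circ f)=\mu(g)\mu(f)$; (d) if $Y' \to Y$ is a map of transitive $G$-sets and $f' \colon X' \to Y'$ is the base change of $f$, then $\mu(f')=\mu(f)$. Put $\mu(X)=\mu(X \to \mathbf{1})$. A measure is regular if $\mu(f)$ is a unit for every map $f$ of transitive $G$-sets. $\Theta(G)$ is the commutative ring generated by classes $[f]$, one for each map $f \colon X \to Y$ in $\mathbf{S}(G)$ with $Y$ transitive, modulo the relations (in the notation of (a)--(d)): $[f]=1$ if $f$ is an isomorphism; $[f]=[f_1]+[f_2]$; $[g \circ f]=[g][f]$; $[f']=[f]$. Thus measures valued in $k$ correspond to ring homomorphisms $\Theta(G) \to k$. For $n \ge 1$, $X(n)$ is the $G$-set of all surjective continuous maps $\mathfrak{X} \to [n]=\{1,\ldots,n\}$ ($[n]$ discrete). Here $\mu$ and $\nu$ denote the unique regular $\mathbf{Q}$-valued measures for $G$ with $\mu(X(n))=(-2)^{n-1}$ and $\nu(X(n))=(-1)^{n-1}$ for all $n \ge 1$. *)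

(* Defs.v *)
From HB Require Import structures.
From mathcomp Require Import all_boot all_order all_algebra.
From mathcomp Require Import all_classical all_reals topology cantor.
From mathcomp Require Import Rstruct.

Set Implicit Arguments.
Unset Strict Implicit.
Unset Printing Implicit Defensive.

Import Order.TTheory GRing.Theory Num.Theory.

Local Open Scope classical_set_scope.

(* The types of G-sets, and with them the ring Theta, live above the universe
   of the space on which G acts, while the topologies of the library live above
   its rings. So the space is taken in a smaller universe: top_space is a copy
   there of topologicalType. *)
Record top_space := TopSpace {
  tcarrier :> Type;
  ttop : Topological.axioms_ tcarrier }.

HB.instance Definition _ (X : top_space) :=
  Topological.copy (tcarrier X) (Topological.Pack (ttop X)).

Definition homeomorphic (X Y : topologicalType) :=
  exists (f : X -> Y) (g : Y -> X),
    [/\ cancel f g, cancel g f, continuous f & continuous g].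

Definition is_cantor (X : topologicalType) := homeomorphic X cantor_space.

Record Homeo (X : top_space) := mkHomeo {
  hmap :> X -> X;
  hinv : X -> X;
  hmapK : cancel hmap hinv;
  hinvK : cancel hinv hmap;
  hmap_cont : continuous hmap;
  hinv_cont : continuous hinv }.

Section HomeoGroup.
Variable X : top_space.
Implicit Types f g h : Homeo X.

Lemma homeoP f g : f =1 g -> f = g.
Proof.
case: f g => [f f' fK f'K fc f'c] [g g' gK g'K gc g'c] /= /funext fg.
subst g.
have ff' : f' = g' by apply/funext => x; rewrite -{1}[x]g'K fK.
by subst g'; congr mkHomeo; exact: Prop_irrelevance.
Qed.

Definition homeo_id : Homeo X :=
  @mkHomeo X id id (fun=> erefl) (fun=> erefl) (fun=> @cvg_id _ _)
    (fun=> @cvg_id _ _).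

Definition homeo_inv f : Homeo X :=
  @mkHomeo X (hinv f) f (hinvK f) (hmapK f) (@hinv_cont _ f)
    (@hmap_cont _ f).

Lemma homeo_mul_cont (u v : X -> X) :
  continuous u -> continuous v -> continuous (u \o v).
Proof. by move=> cu cv x; apply: continuous_comp; [exact: cv|exact: cu]. Qed.

Definition homeo_mul f g : Homeo X :=
  @mkHomeo X (f \o g) (hinv g \o hinv f)
    (can_comp (hmapK f) (hmapK g))
    (can_comp (hinvK g) (hinvK f))
    (homeo_mul_cont (@hmap_cont _ f) (@hmap_cont _ g))
    (homeo_mul_cont (@hinv_cont _ g) (@hinv_cont _ f)).

HB.instance Definition _ := gen_eqMixin (Homeo X).
HB.instance Definition _ := gen_choiceMixin (Homeo X).

Lemma homeo_mulA : associative homeo_mul.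
Proof. by move=> f g h; exact: homeoP. Qed.
Lemma homeo_mul1 : left_id homeo_id homeo_mul.
Proof. by move=> f; exact: homeoP. Qed.
Lemma homeo_1mul : right_id homeo_id homeo_mul.
Proof. by move=> f; exact: homeoP. Qed.
Lemma homeo_mulV : left_inverse homeo_id homeo_inv homeo_mul.
Proof. by move=> f; apply: homeoP => x /=; rewrite hmapK. Qed.
Lemma homeo_Vmul : right_inverse homeo_id homeo_inv homeo_mul.
Proof. by move=> f; apply: homeoP => x /=; rewrite hinvK. Qed.

HB.instance Definition _ := isGroup.Build (Homeo X)
  homeo_mulA homeo_mul1 homeo_1mul homeo_mulV homeo_Vmul.

End HomeoGroup.

Section HomeoTopology.
Variable X : top_space.
Implicit Types (g h : Homeo X) (A : set X) (s : seq (set X)).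

Definition setwise_stab A : set (Homeo X) := [set g | hmap g @` A = A].

Definition clopen_stab : set (set (Homeo X)) :=
  [set E | exists2 s : seq (set X), (forall A, A \in s -> clopen A) &
     E = \bigcap_(A in [set` s]) setwise_stab A].

(* The group topology with clopen_stab as a neighborhood basis of 1. *)
Definition homeo_nbhs g : set_system (Homeo X) :=
  [set U | exists2 E, clopen_stab E & [set (g * h)%g | h in E] `<=` U].

HB.instance Definition _ := hasNbhs.Build (Homeo X) homeo_nbhs.

Lemma setwise_stab1 A : setwise_stab A 1%g.
Proof. by rewrite /setwise_stab /= image_id. Qed.

Lemma setwise_stabM A g h :
  setwise_stab A g -> setwise_stab A h -> setwise_stab A (g * h)%g.
Proof.
rewrite /setwise_stab /= => gA hA.
by rewrite -[LHS](image_comp (hmap h) (hmap g)) hA.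
Qed.

Lemma clopen_stab1 E : clopen_stab E -> E 1%g.
Proof. by move=> [s _ ->] A _; exact: setwise_stab1. Qed.

Lemma clopen_stabM E g h : clopen_stab E -> E g -> E h -> E (g * h)%g.
Proof.
by move=> [s _ ->] Eg Eh A sA; apply: setwise_stabM; [exact: Eg|exact: Eh].
Qed.

Lemma homeo_nbhs_filter g : ProperFilter (nbhs g).
Proof.
split; first by move=> [E /clopen_stab1 E1] /(_ (g * 1)%g); apply; exists 1%g.
split.
- exists setT => //; exists [::]; first by move=> A; rewrite in_nil.
  by apply/esym; rewrite set_nil bigcap_set0.
- move=> U V [_ [s sc ->] sU] [_ [t tc ->] tV].
  exists (\bigcap_(A in [set` s ++ t]) setwise_stab A).
    exists (s ++ t) => // A; rewrite mem_cat => /orP[/sc//|/tc//].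
  move=> _ [h Eh <-]; split; [apply: sU|apply: tV]; exists h => // A /= HA;
    by apply: Eh; rewrite /= mem_cat HA ?orbT.
- by move=> U V UV [E Es EU]; exists E => //; exact: subset_trans UV.
Qed.

Lemma homeo_nbhs_singleton g U : nbhs g U -> U g.
Proof.
by move=> [E /clopen_stab1 E1]; apply; exists 1%g => //; rewrite mulg1.
Qed.

Lemma homeo_nbhs_nbhs g U : nbhs g U -> nbhs g (nbhs^~ U).
Proof.
move=> [E Es EU]; exists E => // _ [h Eh <-]; exists E => // _ [k Ek <-].
by apply: EU; exists (h * k)%g; [exact: clopen_stabM|rewrite mulgA].
Qed.

HB.instance Definition _ := @Nbhs_isNbhsTopological.Build (Homeo X)
  homeo_nbhs_filter homeo_nbhs_singleton homeo_nbhs_nbhs.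

End HomeoTopology.

Section GSets.
Variable X : top_space.

Record gset := GSet {
  gcarrier :> Type;
  gact : Homeo X -> gcarrier -> gcarrier;
  gact1 : forall x, gact 1%g x = x;
  gactM : forall g h x, gact (g * h)%g x = gact g (gact h x);
  gact_smooth : forall x, open [set g | gact g x = x] }.

Definition gorbit (S : gset) (x : S) : set S := range (fun g => gact g x).

Definition finitary (S : gset) := finite_set (range (@gorbit S)).

(* In particular a transitive G-set is nonempty. *)
Definition gtransitive (S : gset) := exists x : S, gorbit x = setT.

Record fgset := FGSet { fgset_gset :> gset; fgsetP : finitary fgset_gset }.

Record gmap (S T : gset) := GMap {
  gfun :> S -> T;
  gfunM : forall g x, gfun (gact g x) = gact g (gfun x) }.

Lemma gcomp_subproof (S T U : gset) (q : gmap T U) (p : gmap S T) g x :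
  (q \o p) (gact g x) = gact g ((q \o p) x).
Proof. by rewrite /= !gfunM. Qed.

Definition gcomp (S T U : gset) (q : gmap T U) (p : gmap S T) : gmap S U :=
  GMap (gcomp_subproof q p).

Definition giso (S T : gset) (p : gmap S T) :=
  exists q : gmap T S, cancel p q /\ cancel q p.

(* S is the disjoint union of S1 and S2, embedded by i1 and i2. *)
Definition gdecomp (S1 S2 S : gset) (i1 : gmap S1 S) (i2 : gmap S2 S) :=
  [/\ injective i1, injective i2 & range i2 = ~` range i1].

(* The square with p : S -> T, q : T' -> T, p' : S' -> T' and q' : S' -> S is
   cartesian, i.e. S' is the fiber product of S and T' over T, so that p' is
   the base change of p along q. *)
Definition gcartesian (S T S' T' : gset)
    (p : gmap S T) (q : gmap T' T) (p' : gmap S' T') (q' : gmap S' S) :=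
  (forall z, p (q' z) = q (p' z)) /\
  (forall x y, p x = q y -> exists! z, q' z = x /\ p' z = y).

Record tmap := TMap {
  tsrc : fgset;
  ttgt : fgset;
  tfun : gmap tsrc ttgt;
  ttgtP : gtransitive ttgt }.

Lemma gone_smooth (x : unit) : open [set g : Homeo X | x = x].
Proof.
suff -> : [set g : Homeo X | x = x] = setT by exact: openT.
by rewrite -subTset => ? _.
Qed.

Definition gone_gset : gset :=
  @GSet unit (fun=> id) (fun=> erefl) (fun _ _ _ => erefl) gone_smooth.

Lemma gone_finitary : finitary gone_gset.
Proof. by apply: finite_image; exact: finite_finset. Qed.

Definition gone : fgset := FGSet gone_finitary.

Lemma gone_transitive : gtransitive gone.
Proof. by exists tt; rewrite -subTset => -[] _; exists 1%g. Qed.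

Definition gto_one (S : gset) : gmap S gone :=
  @GMap S gone (fun=> tt) (fun _ _ => erefl).

Definition tmap_one (S : fgset) : tmap := TMap (gto_one S) gone_transitive.

End GSets.

Section Measures.
Variable X : top_space.
Local Open Scope ring_scope.

Record is_measure (k : comPzRingType) (mu : tmap X -> k) : Prop := IsMeasure {
  measure_iso : forall (S T : fgset X) (p : gmap S T) (tT : gtransitive T),
    giso p -> mu (TMap p tT) = 1;
  measure_add : forall (S1 S2 S T : fgset X) (i1 : gmap S1 S) (i2 : gmap S2 S)
      (p : gmap S T) (tT : gtransitive T),
    gdecomp i1 i2 ->
    mu (TMap p tT) = mu (TMap (gcomp p i1) tT) + mu (TMap (gcomp p i2) tT);
  measure_comp : forall (S T U : fgset X) (p : gmap S T) (q : gmap T U)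
      (tT : gtransitive T) (tU : gtransitive U),
    mu (TMap (gcomp q p) tU) = mu (TMap q tU) * mu (TMap p tT);
  measure_base_change : forall (S T S' T' : fgset X) (p : gmap S T)
      (q : gmap T' T) (p' : gmap S' T') (q' : gmap S' S)
      (tT : gtransitive T) (tT' : gtransitive T'),
    gcartesian p q p' q' -> mu (TMap p' tT') = mu (TMap p tT) }.

Definition regular (k : comUnitRingType) (mu : tmap X -> k) :=
  forall (S T : fgset X) (p : gmap S T) (tS : gtransitive S)
    (tT : gtransitive T), mu (TMap p tT) \is a GRing.unit.

End Measures.

Section PresentedRing.
Local Open Scope quotient_scope.
Variable T : Type.

Inductive rterm :=
| RGen of T
| RZero
| ROne
| ROpp of rterm
| RAdd of rterm & rterm
| RMul of rterm & rterm.

HB.instance Definition _ := gen_eqMixin rterm.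
HB.instance Definition _ := gen_choiceMixin rterm.

Variable rel : rterm -> rterm -> Prop.

(* The smallest congruence that contains rel and whose quotient satisfies the
   axioms of commutative rings. *)
Inductive rcongr : rterm -> rterm -> Prop :=
| rcongr_rel a b : rel a b -> rcongr a b
| rcongr_refl a : rcongr a a
| rcongr_sym a b : rcongr a b -> rcongr b a
| rcongr_trans a b c : rcongr a b -> rcongr b c -> rcongr a c
| rcongr_opp a a' : rcongr a a' -> rcongr (ROpp a) (ROpp a')
| rcongr_add a a' b b' :
    rcongr a a' -> rcongr b b' -> rcongr (RAdd a b) (RAdd a' b')
| rcongr_mul a a' b b' :
    rcongr a a' -> rcongr b b' -> rcongr (RMul a b) (RMul a' b')
| rcongr_addA a b c : rcongr (RAdd a (RAdd b c)) (RAdd (RAdd a b) c)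
| rcongr_addC a b : rcongr (RAdd a b) (RAdd b a)
| rcongr_add0 a : rcongr (RAdd RZero a) a
| rcongr_addN a : rcongr (RAdd (ROpp a) a) RZero
| rcongr_mulA a b c : rcongr (RMul a (RMul b c)) (RMul (RMul a b) c)
| rcongr_mulC a b : rcongr (RMul a b) (RMul b a)
| rcongr_mul1 a : rcongr (RMul ROne a) a
| rcongr_mulDl a b c :
    rcongr (RMul (RAdd a b) c) (RAdd (RMul a c) (RMul b c)).

Lemma rcongr_equiv : equiv_class_of (fun a b => `[< rcongr a b >]).
Proof.
split.
- by move=> a; apply/asboolP; exact: rcongr_refl.
- by move=> a b; apply/asboolP/asboolP; exact: rcongr_sym.
- move=> b a c /asboolP ab /asboolP bc; apply/asboolP.
  exact: rcongr_trans ab bc.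
Qed.

Canonical rcongr_equivRel := EquivRelPack rcongr_equiv.

Definition presented := {eq_quot rcongr_equivRel}.

HB.instance Definition _ := Choice.on presented.

Definition pcls (a : rterm) : presented := \pi_presented a.

Lemma pclsP a b : pcls a = pcls b <-> rcongr a b.
Proof.
split=> [/eqmodP/asboolP//|ab].
by apply/eqmodP/asboolP.
Qed.

Lemma pclsK u : pcls (repr u) = u.
Proof. exact: reprK. Qed.

Lemma repr_pcls a : rcongr (repr (pcls a)) a.
Proof. by apply/pclsP; rewrite pclsK. Qed.

Definition padd (u v : presented) : presented := pcls (RAdd (repr u) (repr v)).
Definition pmul (u v : presented) : presented := pcls (RMul (repr u) (repr v)).
Definition popp (u : presented) : presented := pcls (ROpp (repr u)).

Lemma paddE a b : padd (pcls a) (pcls b) = pcls (RAdd a b).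
Proof. by apply/pclsP/rcongr_add; exact: repr_pcls. Qed.

Lemma pmulE a b : pmul (pcls a) (pcls b) = pcls (RMul a b).
Proof. by apply/pclsP/rcongr_mul; exact: repr_pcls. Qed.

Lemma poppE a : popp (pcls a) = pcls (ROpp a).
Proof. by apply/pclsP/rcongr_opp; exact: repr_pcls. Qed.

Lemma paddA : associative padd.
Proof.
move=> u v w; rewrite -(pclsK u) -(pclsK v) -(pclsK w) !paddE.
by apply/pclsP; exact: rcongr_addA.
Qed.

Lemma paddC : commutative padd.
Proof.
move=> u v; rewrite -(pclsK u) -(pclsK v) !paddE.
by apply/pclsP; exact: rcongr_addC.
Qed.

Lemma padd0 : left_id (pcls RZero) padd.
Proof.
by move=> u; rewrite -(pclsK u) !paddE; apply/pclsP; exact: rcongr_add0.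
Qed.

Lemma paddN : left_inverse (pcls RZero) popp padd.
Proof.
by move=> u; rewrite -(pclsK u) poppE paddE; apply/pclsP; exact: rcongr_addN.
Qed.

Lemma pmulA : associative pmul.
Proof.
move=> u v w; rewrite -(pclsK u) -(pclsK v) -(pclsK w) !pmulE.
by apply/pclsP; exact: rcongr_mulA.
Qed.

Lemma pmulC : commutative pmul.
Proof.
move=> u v; rewrite -(pclsK u) -(pclsK v) !pmulE.
by apply/pclsP; exact: rcongr_mulC.
Qed.

Lemma pmul1 : left_id (pcls ROne) pmul.
Proof.
by move=> u; rewrite -(pclsK u) !pmulE; apply/pclsP; exact: rcongr_mul1.
Qed.

Lemma pmulDl : left_distributive pmul padd.
Proof.
move=> u v w; rewrite -(pclsK u) -(pclsK v) -(pclsK w) !(paddE, pmulE).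
by apply/pclsP; exact: rcongr_mulDl.
Qed.

HB.instance Definition _ :=
  GRing.isZmodule.Build presented paddA paddC padd0 paddN.

HB.instance Definition _ :=
  GRing.Zmodule_isComPzRing.Build presented pmulA pmulC pmul1 pmulDl.

End PresentedRing.

Section Theta.
Variable X : top_space.

Inductive theta_rel : rterm (tmap X) -> rterm (tmap X) -> Prop :=
| theta_iso (S T : fgset X) (p : gmap S T) (tT : gtransitive T) :
    giso p -> theta_rel (RGen (TMap p tT)) (ROne _)
| theta_add (S1 S2 S T : fgset X) (i1 : gmap S1 S) (i2 : gmap S2 S)
      (p : gmap S T) (tT : gtransitive T) :
    gdecomp i1 i2 ->
    theta_rel (RGen (TMap p tT))
      (RAdd (RGen (TMap (gcomp p i1) tT)) (RGen (TMap (gcomp p i2) tT)))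
| theta_comp (S T U : fgset X) (p : gmap S T) (q : gmap T U)
      (tT : gtransitive T) (tU : gtransitive U) :
    theta_rel (RGen (TMap (gcomp q p) tU))
      (RMul (RGen (TMap q tU)) (RGen (TMap p tT)))
| theta_base_change (S T S' T' : fgset X) (p : gmap S T) (q : gmap T' T)
      (p' : gmap S' T') (q' : gmap S' S)
      (tT : gtransitive T) (tT' : gtransitive T') :
    gcartesian p q p' q' ->
    theta_rel (RGen (TMap p' tT')) (RGen (TMap p tT)).

Definition Theta : comPzRingType := presented theta_rel.

Definition theta_class (f : tmap X) : Theta := pcls theta_rel (RGen f).

End Theta.

Lemma homeomorphic_clopen (X Y : topologicalType) (f : X -> Y) (g : Y -> X) A :
  cancel f g -> cancel g f -> continuous g -> clopen A -> clopen (f @` A).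
Proof.
move=> fK gK gc.
have -> : f @` A = g @^-1` A.
  apply/seteqP; split => [_ [x Ax <-]|y Ay] /=; first by rewrite fK.
  by exists (g y).
move=> [oA cA]; split.
  by apply: open_comp => // y _; exact: gc.
by apply: preimage_closed => // y _; exact: gc.
Qed.

Lemma cantor_like_clopen (R : realType) (T : pseudoMetricType R) (A : set T) :
  cantor_like T -> clopen A -> cantor_like (set_type A : topologicalType).
Proof.
move=> [pT cT hT zT] [oA cA].
have val_cont : continuous (set_val : A -> T) by exact: initial_continuous.
split.
- apply/perfectTP => -[x xA] [W oW WE]; move/perfectTP : pT => /(_ x); apply.
  suff -> : [set x] = W `&` A by exact: openI.
  apply/seteqP; split => [_ ->|y [Wy Ay]].
    split; last exact: set_mem.
    by have : [set (exist _ x xA : set_type A)] (exist _ x xA) by []; rewrite -WE.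
  have : (set_val @^-1` W : set A) (exist _ y (mem_set Ay)) by [].
  by rewrite WE => -[].
- move=> F PF FA.
  have cptA : compact A by apply: subclosed_compact cA cT _.
  have [|x [Ax clx]] := cptA (fmap set_val F) _.
    by rewrite /fmap /=; apply: filterS FA => -[y yA] _ /=; exact: set_mem.
  exists (exist _ x (mem_set Ax)); split => // U V FU [_ [[W oW <-] Wx WV]].
  have [] := clx (set_val @` U) W.
  + by rewrite /fmap /=; apply: filterS FU => u Uu; exists u.
  + exact: open_nbhs_nbhs.
  + by move=> _ [[u Uu <-] Wu]; exists u; split => //; exact: WV.
- move=> x y clxy; apply: val_inj; apply: hT => U V Ux Vy.
  have [u [Uu Vu]] := clxy _ _ (val_cont _ _ Ux) (val_cont _ _ Vy).
  by exists (set_val u).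
- move=> x y xy; have /zT[U [[oU cU] Ux Uy]] : set_val x != set_val y.
    by apply: contra_neq xy; exact: val_inj.
  exists (set_val @^-1` U); split => //; split.
    by apply: open_comp => // ? _; exact: val_cont.
  by apply: preimage_closed => // ? _; exact: val_cont.
Qed.

Lemma cantor_like_clopen_param (R : realType) (T : pseudoMetricType R) (A : set T) :
  cantor_like T -> clopen A -> A !=set0 ->
  exists f : cantor_space -> T, [/\ continuous f, injective f & range f = A].
Proof.
move=> cT cA [a Aa].
have cA' := cantor_like_clopen cT cA.
pose pA := isPointed.Build (set_type A) (exist _ a (mem_set Aa)).
pose B : pseudoPMetricType R := HB.pack (set_type A) pA.
have [f [fc _]] := @homeomorphism_cantor_like R B cA'.
exists (fun x => set_val (f x)); split.
- move=> x; apply: continuous_comp; first exact: fc.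
  exact: initial_continuous.
- move=> x y /val_inj fxy; apply: (@inj _ _ setT f _ _ _ _ fxy); exact: in_setT.
- apply/seteqP; split => [_ [x _ <-]|y Ay]; first exact: set_valP.
  have [x _ fx] := @surj _ _ setT setT f (exist _ y (mem_set Ay)) I.
  by exists x => //; rewrite fx.
Qed.

Lemma cantor_closed_image (Y : topologicalType) (f : cantor_space -> Y) K :
  hausdorff_space Y -> continuous f -> closed K -> closed (f @` K).
Proof.
move=> hY fc cK; apply: compact_closed hY _; apply: continuous_compact.
  exact: continuous_subspaceT.
exact: subclosed_compact cK cantor_space_compact _.
Qed.

Lemma cantor_homeo (Y : topologicalType) (f : cantor_space -> Y) :
  hausdorff_space Y -> continuous f -> injective f -> range f = setT ->
  homeomorphic cantor_space Y.
Proof.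
move=> hY fc finj fT.
have [g gK] : {g : Y -> cantor_space & cancel g f}.
  apply: (@choice _ _ (fun y x => f x = y)) => y.
  by have : range f y by [rewrite fT]; move=> [x _ <-]; exists x.
have fK : cancel f g by move=> x; apply: finj; rewrite gK.
exists f, g; split => //.
apply/continuous_closedP => K cK.
suff -> : g @^-1` K = f @` K by exact: cantor_closed_image.
apply/seteqP; split => [y Ky|_ [x Kx <-]] /=; last by rewrite fK.
by exists (g y).
Qed.

Lemma cantor_clopen_param (X : topologicalType) (A : set X) :
  is_cantor X -> clopen A -> A !=set0 ->
  exists f : cantor_space -> X, [/\ continuous f, injective f & range f = A].
Proof.
move=> [k [k' [kK k'K kc k'c]]] cA [a Aa].
pose R : realType := Rdefinitions.R.
pose T : pseudoMetricType R := tree_of (fun=> bool).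
have cT : cantor_like T.
  apply: cantor_like_finite_prod => n; first exact: finite_finset.
  by exists (true, false).
have [|g [gc ginj gT]] := @cantor_like_clopen_param R T setT cT clopenT.
  by exists point.
have [l [l' [lK l'K lc l'c]]] : homeomorphic cantor_space T.
  by apply: cantor_homeo gc ginj gT; case: cT.
have [||f [fc finj fA]] := @cantor_like_clopen_param R T (l @` (k @` A)) cT.
- by apply: homeomorphic_clopen lK l'K l'c _; exact: homeomorphic_clopen cA.
- by exists (l (k a)); exists (k a) => //; exists a.
exists (k' \o l' \o f); split.
- move=> x; apply: continuous_comp; first exact: fc.
  by apply: continuous_comp; [exact: l'c|exact: k'c].
- by move=> x y /(can_inj k'K) /(can_inj l'K) /finj.
- rewrite -[LHS](image_comp f (k' \o l')) fA -image_comp.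
  rewrite (image_comp l) (_ : l' \o l = id); last exact/funext.
  rewrite image_id image_comp (_ : k' \o k = id) ?image_id//.
  exact/funext.
Qed.

Lemma cantor_hausdorff (X : topologicalType) : is_cantor X -> hausdorff_space X.
Proof.
move=> [k [k' [kK _ kc _]]] x y xy; apply: (can_inj kK).
apply: cantor_space_hausdorff => U V Ux Vy.
have [z [Uz Vz]] := xy _ _ (kc _ _ Ux) (kc _ _ Vy).
by exists (k z).
Qed.

Lemma cantor_glue (X : topologicalType) (D : set nat) (p q : X -> nat)
    (f g : nat -> cantor_space -> X) :
  hausdorff_space X -> finite_set D -> (forall x, D (p x)) ->
  (forall i, D i ->
    [/\ continuous (f i), injective (f i) & range (f i) = p @^-1` [set i]]) ->
  (forall i, D i ->
    [/\ continuous (g i), injective (g i) & range (g i) = q @^-1` [set i]]) ->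
  exists h : X -> X, continuous h /\ forall i z, D i -> h (f i z) = g i z.
Proof.
move=> hX fD Dp fP gP.
have [r rP] : {r : X -> cantor_space & forall x, f (p x) (r x) = x}.
  apply: (@choice _ _ (fun x z => f (p x) z = x)) => x.
  have [_ _ fx] := fP _ (Dp x); have : (p @^-1` [set p x]) x by [].
  by rewrite -fx => -[z _ fz]; exists z.
have pf i z : D i -> p (f i z) = i.
  move=> Di; have [_ _ fi] := fP i Di.
  suff : (p @^-1` [set i]) (f i z) by [].
  by rewrite -fi; exists z.
have rf i z : D i -> r (f i z) = z.
  move=> Di; have [_ finj _] := fP i Di.
  by apply: finj; rewrite -{1}(pf i z Di) rP.
exists (fun x => g (p x) (r x)); split; last by move=> i z Di; rewrite pf ?rf.
apply/continuous_closedP => K cK.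
rewrite (_ : _ @^-1` K = \bigcup_(i in D) (f i @` (g i @^-1` K))).
  apply: closed_bigcup => [//|i Di].
  have [fc _ _] := fP i Di; have [gc _ _] := gP i Di.
  by apply: cantor_closed_image => //; move/continuous_closedP: gc; apply.
apply/seteqP; split => [x Kx|_ [i Di [z Kz <-]]] /=; last by rewrite pf ?rf.
by exists (p x) => //; exists (r x).
Qed.

Section SurjSets.
Variables (X : top_space) (n : nat).

Definition bracket : set nat := [set i | (1 <= i <= n)%N].

Lemma bracket_finite : finite_set bracket.
Proof.
apply: (@sub_finite_set _ _ `I_n.+1); last exact: finite_II.
by move=> i /andP[_]; rewrite /= ltnS.
Qed.

(* The topology of nat is discrete. *)
Definition surj_fun := {f : X -> nat | continuous f /\ range f = bracket}.

Lemma surj_act_subproof (g : Homeo X) (f : surj_fun) :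
  continuous (sval f \o hmap (g^-1)%g) /\
  range (sval f \o hmap (g^-1)%g) = bracket.
Proof.
case: f => f [fc fT] /=; split.
  by move=> x; apply: continuous_comp; [exact: (@hmap_cont _ (g^-1)%g)|exact: fc].
rewrite -fT; apply/seteqP; split => [_ [x _ <-]|_ [x _ <-]].
  by exists (hinv g x).
by exists (g x) => //=; congr f; exact: hmapK.
Qed.

Definition surj_act g f : surj_fun := exist _ _ (surj_act_subproof g f).

Lemma surj_funP (f f' : surj_fun) : sval f = sval f' -> f = f'.
Proof. by apply: eq_sig_hprop => ? ? ?; exact: Prop_irrelevance. Qed.

Lemma surj_act1 f : surj_act 1%g f = f.
Proof. exact: surj_funP. Qed.

Lemma surj_actM g h f : surj_act (g * h)%g f = surj_act g (surj_act h f).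
Proof. exact: surj_funP. Qed.

Lemma surj_fun_clopen (f : surj_fun) i : clopen (sval f @^-1` [set i]).
Proof.
case: f => f [fc _] /=; split.
  by move/continuousP : fc; apply; exact: discrete_open.
by move/continuous_closedP : fc; apply; exact: discrete_closed.
Qed.

Lemma surj_funD (f : surj_fun) x : bracket (sval f x).
Proof.
case: f => f [_ fE] /=.
by rewrite -[bracket _]/((fun B => B (f x)) bracket) -fE; exists x.
Qed.

Lemma surj_smooth f : open [set g | surj_act g f = f].
Proof.
rewrite openE => g gf.
pose s := [seq sval f @^-1` [set i] | i <- iota 1 n].
exists (\bigcap_(A in [set` s]) setwise_stab A).
  by exists s => // _ /mapP[i _ ->]; exact: surj_fun_clopen.
move=> _ [h sh <-] /=; rewrite surj_actM -[RHS]gf; congr surj_act.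
apply/surj_funP/funext => x /=; set y := hinv h x.
have /sh hy : [set` s] (sval f @^-1` [set sval f y]).
  apply/mapP; exists (sval f y) => //; rewrite mem_iota add1n ltnS.
  exact: surj_funD.
have : (hmap h @` (sval f @^-1` [set sval f y])) x.
  by exists y => //; rewrite /y; exact: hinvK.
by rewrite hy.
Qed.

Definition surj_gset : gset X := GSet surj_act1 surj_actM surj_smooth.

Lemma surj_orbit (cX : is_cantor X) (f : surj_gset) : gorbit f = setT.
Proof.
have hX := cantor_hausdorff cX; have [_ [k _]] := cX.
have par (e : surj_fun) : {F : nat -> cantor_space -> X & forall i, bracket i ->
    [/\ continuous (F i), injective (F i) &
        range (F i) = sval e @^-1` [set i]]}.
  apply: (@choice _ _ (fun i F => bracket i -> [/\ continuous F, injective F &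
    range F = sval e @^-1` [set i]])) => i.
  have [Di|nDi] := pselect (bracket i); last by exists k.
  have [||F FP] := @cantor_clopen_param X (sval e @^-1` [set i]) cX.
  - exact: surj_fun_clopen.
  - by case: e => e [_ eT] /=; move: Di; rewrite -eT => -[x _ ex]; exists x.
  - by exists F.
rewrite -subTset => f' _.
have [F FP] := par f; have [F' FP'] := par f'.
have [h [hc hF]] := cantor_glue hX bracket_finite (surj_funD f) FP FP'.
have [h' [hc' hF']] := cantor_glue hX bracket_finite (surj_funD f') FP' FP.
have FE (e : surj_fun) (E : nat -> cantor_space -> X) : (forall i, bracket i ->
    [/\ continuous (E i), injective (E i) &
    range (E i) = sval e @^-1` [set i]]) ->
    forall x, exists z, x = E (sval e x) z.
  move=> EP x; have [_ _ Ex] := EP _ (surj_funD e x).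
  have : (sval e @^-1` [set sval e x]) x by [].
  by rewrite -Ex => -[z _ Ez]; exists z.
have hK : cancel h h'.
  move=> x; have [z ->] := FE _ _ FP x; have Dx := surj_funD f x.
  by rewrite hF ?hF'.
have hK' : cancel h' h.
  move=> x; have [z ->] := FE _ _ FP' x; have Dx := surj_funD f' x.
  by rewrite hF' ?hF.
exists (mkHomeo hK hK' hc hc') => //; apply/surj_funP/funext => x /=.
have [z xE] := FE _ _ FP' x; have Dx := surj_funD f' x.
rewrite {1}xE hF'//; have [_ _ Fi] := FP _ Dx.
suff : (sval f @^-1` [set sval f' x]) (F (sval f' x) z) by [].
by rewrite -Fi; exists z.
Qed.

Lemma surj_finitary (cX : is_cantor X) : finitary surj_gset.
Proof.
apply: (@sub_finite_set _ _ [set setT]); last exact: finite_set1.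
by move=> _ [f _ <-]; exact: surj_orbit.
Qed.

Definition surj_fgset (cX : is_cantor X) : fgset X := FGSet (surj_finitary cX).

End SurjSets.

Definition Z_2loc : set rat := [set x | odd `|denq x|%N].

(* Main.v *)
From HB Require Import structures.
Require Import Defs.
From mathcomp Require Import all_boot all_order all_algebra.
From mathcomp Require Import all_fingroup all_solvable ring.
From mathcomp Require Import all_classical topology cantor.
Import Defs.

(** Why the theorem is true. Let X(n) be the set of ordered partitions of the
    Cantor space into n nonempty clopen parts; its points are labelings of the
    space by 'I_n. G is transitive on X(n), and the orbit of a finite family of
    labelings is determined by its pattern, the set of tuples of labels that
    occur together. So every computation with these G-sets is combinatorics of
    finite sets of labels.

    Every transitive G-set S receives a map from some X(n). If n is minimal, S is
    the quotient X(n) / H by a group H of permutations of the parts: if two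
    partitions P, Q with the same image in S did not have the same parts,
    composing the pattern of (P, Q) with its transpose would show that the map
    X(n) -> S forgets how two of the parts are separated, so it would factor
    through X(n-1) (minimal_refines, minimal_quotient). After base change to some
    X(m) and decomposition into orbits, Theta is therefore generated by the
    classes [X(n)/H -> X(m)], where H acts along the fibers of a surjection r of
    labels (quot_class).
    Two rules compute with them: enlarging H divides the class by an index
    (quot_class_index), and a surjection of labels along which H descends factors
    the class (quot_class_base_change).

    Let p be the class of the map that forgets how one part is cut in two, and t
    the class of the same map on unordered cuts, so that p = 2 t. Pulling back an
    unordered cut of a part A to a space where A = A' + A'' is already cut leaves
    four cases, according to which of A' and A'' is cut in turn. This gives
    t = 1 + 2 p + t p (split_relation). Hence p^2 + 3 p + 2 = 0, so e = p + 2 is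
    idempotent, and Theta splits into a factor e = 0, where p = -2 as for mu, and a
    factor e = 1, where p = -1 as for nu. The relation for t also says
    t + 1 = e (t + 1), so t = -1 on the first factor although 2 need not be
    regular there a priori.

    The class of X(n) -> X(n)/C for a cyclic group C of order n is n, and
    [X(n) -> X(1)] = p^(n-1); so n is invertible where p = -1, and also where
    p = -2 when n is odd. It remains to see that every quot_class is an
    integer divided by an odd number on the first factor, and by a positive number
    on the second (is_rational). By the index formula it is enough to treat the
    full group of symmetries W of a surjection r (is_rational_fixg). If W is not
    trivial, its order is even, and it contains an involution z whose centralizer
    has odd index. Merging the parts exchanged by z factors the class through
    fewer parts, and the class of the merging is, up to indices, a product of
    classes like t.

    So Theta is generated over the integers by e and by the inverses just found.
    An element killed by mu and nu is 0 because each of its two components is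
    killed by an integer that is invertible there; and the inverses provide all of
    Z_(2) times Q as values of (mu, nu). *)

Set Implicit Arguments.
Unset Strict Implicit.
Unset Printing Implicit Defensive.

Import GRing.Theory Num.Theory.

Local Open Scope classical_set_scope.
Local Open Scope ring_scope.

(** * Labelings of the space by finite sets *)

Section Labelings.
Variable X : top_space.

Definition clopen_fibers (I : finType) (Z : X -> I) :=
  forall i, clopen (Z @^-1` [set i]).

Lemma clopen_fibers_preimage (I : finType) (Z : X -> I) (A : set I) :
  clopen_fibers Z -> clopen (Z @^-1` A).
Proof.
move=> Zc.
have -> : Z @^-1` A = \bigcup_(i in A) Z @^-1` [set i].
  by apply/seteqP; split=> [x Ax|x [i Ai /= ->]] //; exists (Z x).
split; first by apply: bigcup_open => i _; case: (Zc i).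
by apply: closed_bigcup => [|i _]; [exact: finite_finset|case: (Zc i)].
Qed.

Lemma clopen_fibers_comp (I J : finType) (r : I -> J) (Z : X -> I) :
  clopen_fibers Z -> clopen_fibers (r \o Z).
Proof. by move=> Zc j; rewrite comp_preimage; exact: clopen_fibers_preimage. Qed.

Lemma clopen_fibers_pair (I J : finType) (Z : X -> I) (Y : X -> J) :
  clopen_fibers Z -> clopen_fibers Y -> clopen_fibers (fun x => (Z x, Y x)).
Proof.
move=> Zc Yc [i j].
have -> : (fun x => (Z x, Y x)) @^-1` [set (i, j)] =
    Z @^-1` [set i] `&` Y @^-1` [set j].
  by apply/seteqP; split=> [x [/= -> ->]|x [/= -> ->]].
by apply: clopenI.
Qed.

Hypothesis cX : is_cantor X.

(** Numbering the common values turns both labelings into points of one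
    set of surjections onto an interval of integers, where G is transitive. *)
Lemma homogeneous (I : finType) (Z Y : X -> I) :
  clopen_fibers Z -> clopen_fibers Y -> range Z = range Y ->
  exists g : Homeo X, forall x, Y (g x) = Z x.
Proof.
move=> Zc Yc ZY.
pose s := [seq i <- enum I | `[< range Z i >]].
have sP i : (i \in s) = `[< range Z i >] by rewrite mem_filter mem_enum andbT.
pose rk i := (index i s).+1.
have ok (W : X -> I) : clopen_fibers W -> range W = range Z ->
    continuous (rk \o W) /\ range (rk \o W) = bracket (size s).
  move=> Wc WZ; split.
    apply/continuousP => A _; rewrite comp_preimage.
    by case: (clopen_fibers_preimage (rk @^-1` A) Wc).
  apply/seteqP; split=> [_ [x _ <-]|[//|i] /= lei].
    rewrite /bracket /rk /= index_mem sP; apply/asboolP.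
    by rewrite -WZ; exists x.
  have xs : (i < size s)%N by [].
  have [i0 i0s] : exists i0, i0 \in s.
    by case: (s) xs => // i0 s' _; exists i0; rewrite mem_head.
  have : range W (nth i0 s i).
    by rewrite WZ; apply/asboolP; rewrite -sP mem_nth.
  move=> [x _ Wx]; exists x => //=.
  by rewrite /rk Wx index_uniq // filter_uniq // enum_uniq.
pose zf : surj_gset X (size s) := exist _ _ (ok Z Zc erefl).
pose yf : surj_gset X (size s) := exist _ _ (ok Y Yc (esym ZY)).
have : gorbit zf yf by rewrite surj_orbit.
move=> [g _ gzy]; exists g => x.
have /(congr1 (@^~ (hmap g x))) /= := congr1 sval gzy.
rewrite /rk [hinv g _]hmapK => -[] /esym/(index_inj (Z x)); apply;
  rewrite sP; apply/asboolP.
  by rewrite ZY; exists (hmap g x).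
by exists x.
Qed.

(** The coordinates of a point of the Cantor space realize every family of
    bits; the label of a point is an element of A at which its bit is set. *)
Lemma exists_labeling (I : finType) (A : set I) :
  A !=set0 -> exists2 Z : X -> I, clopen_fibers Z & range Z = A.
Proof.
move=> [i0 Ai0]; have [k [k' [kK k'K kc _]]] := cX.
pose bits x : {ffun I -> bool} := [ffun i => k x (enum_rank i)].
have bitsc : clopen_fibers bits.
  move=> b.
  have tclass i : clopen [set x | k x (enum_rank i) = ~~ b i].
    have pc : continuous (fun c : cantor_space => c (enum_rank i : nat)).
      exact: proj_continuous.
    rewrite -[[set _ | _]]/(k @^-1` ((fun c => c (enum_rank i : nat))
      @^-1` [set ~~ b i])).
    apply: preimage_clopen kc; apply: preimage_clopen pc.
    by split; [exact: discrete_open|exact: discrete_closed].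
  have -> : bits @^-1` [set b] =
      ~` \bigcup_(i in [set: I]) [set x | k x (enum_rank i) = ~~ b i].
    apply/seteqP; split=> [x /= <- [i _] /=|x xb] /=.
      by rewrite ffunE; case: (k x _).
    apply/ffunP => i; rewrite ffunE; apply/eqP/negPn/negP => kxb.
    by apply: xb; exists i => //=; case: (k x _) (b i) kxb => -[].
  apply: (clopenC set0); split; first by apply: bigcup_open => i _; case: (tclass i).
  by apply: closed_bigcup => [|i _]; [exact: finite_finset|case: (tclass i)].
pose label (b : {ffun I -> bool}) := odflt i0 [pick i | `[< A i >] && b i].
exists (label \o bits); first exact: clopen_fibers_comp.
apply/seteqP; split=> [_ [x _ <-]|i Ai].
  by rewrite /label /=; case: pickP => [i /andP[/asboolP]|].
exists (k' (fun n => n == enum_rank i :> nat)) => //=; rewrite /label.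
case: pickP => [j|/(_ i)].
  by rewrite ffunE k'K => /andP[_ /eqP/ord_inj/enum_rank_inj].
by rewrite ffunE k'K eqxx andbT; move/asboolP.
Qed.

End Labelings.

(** * Constructions on sets with a smooth action *)

Section GSetTools.
Variable X : top_space.
Implicit Types S T U : gset X.

Lemma gmap_ext S T (p q : gmap S T) : p =1 q -> p = q.
Proof.
case: p q => [p pM] [q qM] /= /funext pq; subst q; congr GMap.
exact: Prop_irrelevance.
Qed.

Lemma gactK S g : cancel (@gact X S g) (gact (g^-1)%g).
Proof. by move=> s; rewrite -gactM mulVg gact1. Qed.

Lemma gactVK S g : cancel (@gact X S (g^-1)%g) (gact g).
Proof. by move=> s; rewrite -gactM mulgV gact1. Qed.

Definition gid S : gmap S S := @GMap X S S id (fun _ _ => erefl).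

Lemma gorbitP S (s t : S) : gorbit s t <-> exists g, gact g s = t.
Proof. by split=> [[g _ <-]|[g <-]]; exists g. Qed.

Lemma gorbit_eq S (s t : S) : gorbit s t -> gorbit s = gorbit t.
Proof.
move=> [g _ <-]; apply/seteqP; split=> [_ [h _ <-]|_ [h _ <-]].
  by exists (h * g^-1)%g => //; rewrite gactM gactK.
by exists (h * g)%g => //; rewrite gactM.
Qed.

Lemma gorbit_refl S (s : S) : gorbit s s.
Proof. by exists 1%g => //; rewrite gact1. Qed.

Lemma gorbit_image S T (e : gmap S T) (s : S) : gorbit (e s) = e @` gorbit s.
Proof.
apply/seteqP; split=> [_ [g _ <-]|_ [_ [g _ <-] <-]].
  by exists (gact g s); rewrite ?gfunM //; exists g.
by exists g => //; rewrite gfunM.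
Qed.

Lemma gtransitiveP S : gtransitive S -> forall s t : S, exists g, gact g s = t.
Proof.
move=> [u uT] s t.
have /gorbitP[g <-] : gorbit u s by rewrite uT.
have /gorbitP[h <-] : gorbit u t by rewrite uT.
by exists (h * g^-1)%g; rewrite gactM gactK.
Qed.

Lemma gtransitiveI S (s : S) : (forall t, exists g, gact g s = t) -> gtransitive S.
Proof. by move=> sP; exists s; rewrite -subTset => t _; apply/gorbitP. Qed.

Lemma gmap_surj S T (f : gmap S T) (s0 : S) :
  gtransitive T -> forall t, exists s, f s = t.
Proof.
move=> tT t; have [g <-] := gtransitiveP tT (f s0) t.
by exists (gact g s0); rewrite gfunM.
Qed.

(** A stabilizer is open as soon as it contains an open subgroup, so
    smoothness is inherited from any point with a smaller stabilizer. *)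
Lemma smooth_dominated (C : Type) (act : Homeo X -> C -> C)
    (actM : forall g h c, act (g * h)%g c = act g (act h c)) (c : C) S (s : S) :
  (forall g, gact g s = s -> act g c = c) -> open [set g | act g c = c].
Proof.
move=> sc; rewrite openE => g gc.
have : nbhs (1%g : Homeo X) [set h | gact h s = s].
  by apply: open_nbhs_nbhs; split; [exact: gact_smooth|exact: gact1].
move=> [E Es Esub]; exists E => // _ [h Eh <-] /=.
rewrite actM sc //; suff : [set h | gact h s = s] h by [].
by apply: Esub; exists h => //; rewrite mul1g.
Qed.

Lemma finitary_jointly (F : gset X) d (R : nat -> gset X)
    (e : forall i, gmap (R i) F) :
  (forall i, (i < d)%N -> finitary (R i)) ->
  (forall z, exists i w, (i < d)%N /\ e i w = z) -> finitary F.
Proof.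
move=> Rfin eF.
apply: (@sub_finite_set _ _ (\bigcup_(i in `I_d)
    ((fun O => e i @` O) @` range (@gorbit X (R i))))).
  move=> _ [z _ <-]; have [i [w [id <-]]] := eF z.
  by exists i => //; exists (gorbit w); [exists w|rewrite gorbit_image].
apply: bigcup_finite; first exact: finite_II.
by move=> i id; apply: finite_image; exact: Rfin.
Qed.

Lemma finitary_classified (F : gset X) (I : finType) (P : F -> I -> Prop) :
  (forall z, exists i, P z i) ->
  (forall i z w, P z i -> P w i -> exists g, gact g z = w) -> finitary F.
Proof.
move=> /choice[c cP] PF.
apply: (@sub_finite_set _ _ (range (fun i => \bigcup_(z in c @^-1` [set i]) gorbit z))).
  move=> _ [z _ <-]; exists (c z) => //; apply/seteqP; split=> [u [w /= wz]|u zu].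
    have /gorbitP/gorbit_eq -> // : exists g, gact g z = w.
    by apply: (PF (c z)) => //; rewrite -wz.
  by exists z.
by apply: finite_image; exact: finite_finset.
Qed.

Section Sub.
Variables (S : gset X) (A : set S).

(** Points whose whole orbit lies in A: this is stable under G for every A, and it
    is A itself if A is invariant. *)
Definition sub_car := {s : S | forall g, A (gact g s)}.

Lemma sub_act_subproof h (s : sub_car) g : A (gact g (gact h (sval s))).
Proof. by rewrite -gactM; exact: svalP s _. Qed.

Definition sub_act h (s : sub_car) : sub_car := exist _ _ (sub_act_subproof h s).

Lemma sub_carP (s t : sub_car) : sval s = sval t -> s = t.
Proof. by apply: eq_sig_hprop => ? ? ?; exact: Prop_irrelevance. Qed.

Lemma sub_act1 s : sub_act 1%g s = s.
Proof. by apply: sub_carP; rewrite /= gact1. Qed.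

Lemma sub_actM g h s : sub_act (g * h)%g s = sub_act g (sub_act h s).
Proof. by apply: sub_carP; rewrite /= gactM. Qed.

Lemma sub_smooth s : open [set g | sub_act g s = s].
Proof.
by apply: (smooth_dominated sub_actM (s := sval s)) => g gs; exact: sub_carP.
Qed.

Definition sub_gset : gset X := GSet sub_act1 sub_actM sub_smooth.

Definition sub_incl : gmap sub_gset S := @GMap X sub_gset S sval (fun _ _ => erefl).

Lemma sub_incl_inj : injective sub_incl. Proof. exact: sub_carP. Qed.

Lemma sub_elt s : (forall g s, A s -> A (gact g s)) -> A s ->
  exists t : sub_gset, sval t = s.
Proof. by move=> Ai As; exists (exist _ s (fun g => Ai g _ As)). Qed.

Lemma sub_finitary : finitary S -> finitary sub_gset.
Proof.
move=> Sfin; apply: (@sub_finite_set _ _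
    ((fun O : set S => sub_incl @^-1` O) @` range (@gorbit X S))).
  move=> _ [s _ <-]; exists (gorbit (sub_incl s)); first by exists (sub_incl s).
  rewrite gorbit_image; apply/seteqP; split=> [t [u su /sub_incl_inj <-] //|t st].
  by exists t.
exact: finite_image.
Qed.

Lemma sub_val (s : sub_gset) : A (sval s).
Proof. by have := svalP s 1%g; rewrite gact1. Qed.

Section Corestriction.
Variables (R : gset X) (e : gmap R S) (eA : forall w, A (e w)).

Lemma corestrict_subproof w g : A (gact g (e w)).
Proof. by rewrite -gfunM. Qed.

Lemma corestrictM g w :
  exist (fun s : S => forall g, A (gact g s)) _ (corestrict_subproof (gact g w))
  = sub_act g (exist _ _ (corestrict_subproof w)).
Proof. by apply: sub_carP; rewrite /= gfunM. Qed.

Definition corestrict : gmap R sub_gset :=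
  @GMap X R sub_gset (fun w => exist _ _ (corestrict_subproof w)) corestrictM.

End Corestriction.

End Sub.

Section Fiber.
Variables (S U T : gset X) (f : gmap S T) (h : gmap U T).

Definition fib_car := {z : S * U | f z.1 = h z.2}.

Lemma fib_act_subproof g (z : fib_car) :
  f (gact g (sval z).1, gact g (sval z).2).1 =
  h (gact g (sval z).1, gact g (sval z).2).2.
Proof. by rewrite !gfunM (svalP z). Qed.

Definition fib_act g (z : fib_car) : fib_car := exist _ _ (fib_act_subproof g z).

Lemma fib_carP (z w : fib_car) :
  (sval z).1 = (sval w).1 -> (sval z).2 = (sval w).2 -> z = w.
Proof.
case: z w => [[a b] ab] [[a' b'] ab'] /= aE bE; subst a' b'.
by congr exist; exact: Prop_irrelevance.
Qed.

Lemma fib_act1 z : fib_act 1%g z = z.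
Proof. by apply: fib_carP; rewrite /= gact1. Qed.

Lemma fib_actM g k z : fib_act (g * k)%g z = fib_act g (fib_act k z).
Proof. by apply: fib_carP; rewrite /= gactM. Qed.

Lemma fib_smooth z : open [set g | fib_act g z = z].
Proof.
rewrite (_ : [set g | _] = [set g | gact g (sval z).1 = (sval z).1] `&`
    [set g | gact g (sval z).2 = (sval z).2]).
  by apply: openI; exact: gact_smooth.
apply/seteqP; split=> [g /= zE|g [z1 z2]]; last exact: fib_carP.
by split; rewrite -[in RHS]zE.
Qed.

Definition fib_gset : gset X := GSet fib_act1 fib_actM fib_smooth.

Definition fib1 : gmap fib_gset S :=
  @GMap X fib_gset S (fun z => (sval z).1) (fun _ _ => erefl).

Definition fib2 : gmap fib_gset U :=
  @GMap X fib_gset U (fun z => (sval z).2) (fun _ _ => erefl).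

Lemma fib_cartesian : gcartesian f h fib2 fib1.
Proof.
split=> [z|x y xy]; first exact: (svalP z).
exists (exist (fun z : S * U => f z.1 = h z.2) (x, y) xy); split=> // w [wx wy].
by apply: fib_carP; rewrite ?wx ?wy.
Qed.

End Fiber.

Lemma gmap_factor S T U (q : gmap S T) (r : gmap S U) :
  (forall t, exists s, q s = t) -> (forall s s', q s = q s' -> r s = r s') ->
  exists f : gmap T U, forall s, f (q s) = r s.
Proof.
move=> /choice[c cK] qr.
have fM g t : r (c (gact g t)) = gact g (r (c t)).
  by rewrite -gfunM; apply: qr; rewrite gfunM !cK.
by exists (GMap fM) => s /=; apply: qr.
Qed.

End GSetTools.

(** * Calculus of classes *)

Section ThetaTools.
Variable X : top_space.
Implicit Types S T U : fgset X.

Definition tclass S T (f : gmap S T) (tT : gtransitive T) : Theta X :=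
  theta_class (TMap f tT).

Lemma tclass_ext S T (f g : gmap S T) tT : f =1 g -> tclass f tT = tclass g tT.
Proof. by move=> /gmap_ext ->. Qed.

Lemma tclass_iso S T (f : gmap S T) tT : giso f -> tclass f tT = 1.
Proof.
by move=> fi; apply/(pclsP (@theta_rel X)); apply: rcongr_rel; exact: theta_iso.
Qed.

Lemma tclass_add (S1 S2 S T : fgset X) (i1 : gmap S1 S) (i2 : gmap S2 S)
    (p : gmap S T) tT :
  gdecomp i1 i2 -> tclass p tT = tclass (gcomp p i1) tT + tclass (gcomp p i2) tT.
Proof.
move=> dec; rewrite /tclass /theta_class [RHS]paddE.
by apply/(pclsP (@theta_rel X)); apply: rcongr_rel; exact: theta_add.
Qed.

Lemma tclass_comp S T U (p : gmap S T) (q : gmap T U) tT tU :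
  tclass (gcomp q p) tU = tclass q tU * tclass p tT.
Proof.
rewrite /tclass /theta_class [RHS]pmulE.
by apply/(pclsP (@theta_rel X)); apply: rcongr_rel; exact: theta_comp.
Qed.

Lemma tclass_base_change (S T S' T' : fgset X) (p : gmap S T) (q : gmap T' T)
    (p' : gmap S' T') (q' : gmap S' S) tT tT' :
  gcartesian p q p' q' -> tclass p' tT' = tclass p tT.
Proof.
move=> c; apply/(pclsP (@theta_rel X)); apply: rcongr_rel.
exact: theta_base_change c.
Qed.

Lemma giso_bij (S T : gset X) (f : gmap S T) :
  injective f -> (forall t, exists s, f s = t) -> giso f.
Proof.
move=> finj fsurj; have [c cK] := choice fsurj.
have cM g t : c (gact g t) = gact g (c t).
  by apply: finj; rewrite gfunM !cK.
by exists (GMap cM); split=> // s; apply: finj; rewrite /= cK.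
Qed.

(** The source is an arbitrary finitary G-set, to which the rule for composites does
    not apply; the square over the identity of the target is cartesian. *)
Lemma tclass_source (S S' T : fgset X) (i : gmap S' S) (p : gmap S T) tT :
  injective i -> (forall s, exists s', i s' = s) -> tclass (gcomp p i) tT = tclass p tT.
Proof.
move=> iinj isurj; apply: (@tclass_base_change _ _ _ _ _ (gid T) _ i).
split=> [//|x y /= xy]; have [s' s'x] := isurj x.
exists s'; split; first by rewrite s'x xy.
by move=> u [ux _]; apply: iinj; rewrite ux.
Qed.

(** The empty set is the disjoint union of two copies of itself. *)
Lemma tclass_empty S T (f : gmap S T) tT : (S -> False) -> tclass f tT = 0.
Proof.
move=> S0; have dec : gdecomp (gid S) (gid S).
  by split=> //; apply/seteqP; split=> s; case: (S0 s).
have /eqP := tclass_add f tT dec.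
rewrite (tclass_ext (g := f)) // -[X in X == _]addr0 => /eqP/addrI.
by move=> ->.
Qed.

Definition subF S (A : set S) : fgset X := FGSet (sub_finitary A (@fgsetP _ S)).

Definition tclass_on S T (f : gmap S T) tT (A : set S) : Theta X :=
  tclass (gcomp f (sub_incl A) : gmap (subF A) T) tT.

Definition ginvariant (S : gset X) (A : set S) := forall g s, A s -> A (gact g s).

Lemma tclass_onU S T (f : gmap S T) tT (A B : set S) :
  ginvariant A -> ginvariant B -> (forall s, A s -> B s -> False) ->
  tclass_on f tT (A `|` B) = tclass_on f tT A + tclass_on f tT B.
Proof.
move=> Ai Bi AB.
pose iA : gmap (subF A) (subF (A `|` B)) :=
  @corestrict _ _ (A `|` B) (sub_gset A) (sub_incl A) (fun s => or_introl (sub_val s)).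
pose iB : gmap (subF B) (subF (A `|` B)) :=
  @corestrict _ _ (A `|` B) (sub_gset B) (sub_incl B) (fun s => or_intror (sub_val s)).
have dec : gdecomp iA iB.
  split=> [s t /(congr1 sval) /= /sub_carP //|s t /(congr1 sval) /= /sub_carP //|].
  apply/seteqP; split=> [_ [s _ <-] [t _ /(congr1 sval) /= ts]|u uA].
    by apply: (AB (sval t)); [exact: sub_val|rewrite ts; exact: sub_val].
  have nA : ~ A (sval u).
    move=> Au; apply: uA.
    have [t tu] := sub_elt Ai Au.
    by exists t => //; exact: sub_carP.
  have Bu : B (sval u) by have [] := sub_val u.
  have [t tu] := sub_elt Bi Bu.
  by exists t => //; exact: sub_carP.
rewrite /tclass_on (tclass_add _ _ dec); congr (_ + _); exact: tclass_ext.
Qed.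

Lemma tclass_onT S T (f : gmap S T) tT (A : set S) :
  (forall s, A s) -> tclass_on f tT A = tclass f tT.
Proof.
move=> AT; apply: tclass_source; first exact: sub_incl_inj.
by move=> s; exists (exist _ s (fun g => AT _)).
Qed.

Lemma tclass_on0 S T (f : gmap S T) tT (A : set S) :
  (forall s, ~ A s) -> tclass_on f tT A = 0.
Proof. by move=> A0; apply: tclass_empty => s; exact: A0 (sub_val s). Qed.

Lemma tclass_on_sum S T (f : gmap S T) tT d (A : nat -> set S) :
  (forall i, ginvariant (A i)) ->
  (forall i j s, (i < d)%N -> (j < d)%N -> A i s -> A j s -> i = j) ->
  tclass_on f tT (\bigcup_(i in `I_d) A i) = \sum_(i < d) tclass_on f tT (A i).
Proof.
move=> Ai; elim: d => [|d IHd] dis.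
  by rewrite big_ord0 tclass_on0 // => s [].
rewrite big_ord_recr /= -IHd; last first.
  by move=> i j s id jd; apply: dis; exact: ltnW.
rewrite -tclass_onU.
- congr tclass_on; apply/seteqP; split=> [s [i /= id Ais]|s [[i /= id Ais]|Ads]].
  + move: id; rewrite ltnS leq_eqVlt => /orP[/eqP ide|id]; last by left; exists i.
    by right; rewrite -ide.
  + by exists i => //=; exact: ltnW.
  + by exists d => /=.
- by move=> g s [i id Ais]; exists i => //; exact: Ai.
- exact: Ai.
- move=> s [i /= id Ais] Ads.
  have := dis i d s (ltnW id) (ltnSn d) Ais Ads.
  by move=> ide; rewrite ide ltnn in id.
Qed.

(** A piece of the fiber product of S and U over some T, by its two projections. *)
Record leg S U := Leg {
  leg_src : fgset X;
  leg1 : gmap leg_src S;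
  leg2 : gmap leg_src U }.

(** Base change along h replaces S by the fiber product of S and U over T; the
    hypotheses say that the legs parametrize it without repetition. *)
Lemma tclass_legs S T U (f : gmap S T) (h : gmap U T) tT tU d (L : nat -> leg S U) :
  (forall i z, f (leg1 (L i) z) = h (leg2 (L i) z)) ->
  (forall i z w, (i < d)%N -> leg1 (L i) z = leg1 (L i) w ->
     leg2 (L i) z = leg2 (L i) w -> z = w) ->
  (forall i j z w, (i < d)%N -> (j < d)%N -> leg1 (L i) z = leg1 (L j) w ->
     leg2 (L i) z = leg2 (L j) w -> i = j) ->
  (forall s u, f s = h u ->
     exists i z, [/\ (i < d)%N, leg1 (L i) z = s & leg2 (L i) z = u]) ->
  tclass f tT = \sum_(i < d) tclass (leg2 (L i)) tU.
Proof.
move=> Lc Linj Ldis Lcov.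
have eM i g w : exist (fun z : S * U => f z.1 = h z.2)
    (leg1 (L i) (gact g w), leg2 (L i) (gact g w)) (Lc i (gact g w)) =
  fib_act g (exist (fun z : S * U => f z.1 = h z.2)
    (leg1 (L i) w, leg2 (L i) w) (Lc i w)).
  by apply: fib_carP; rewrite /= gfunM.
pose e i : gmap (leg_src (L i)) (fib_gset f h) :=
  @GMap X (leg_src (L i)) (fib_gset f h)
    (fun w => exist (fun z : S * U => f z.1 = h z.2) (_, _) (Lc i w)) (eM i).
have ecov z : exists i w, (i < d)%N /\ e i w = z.
  have [i [w [id w1 w2]]] := Lcov _ _ (svalP z).
  by exists i, w; split=> //; exact: fib_carP.
have Ffin : finitary (fib_gset f h).
  by apply: finitary_jointly ecov => i _; exact: fgsetP.
pose F := FGSet Ffin.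
pose A i : set F := range (e i).
have Ai i : ginvariant (A i).
  by move=> g _ [w _ <-]; exists (gact g w) => //; exact: gfunM.
rewrite -(tclass_base_change tT tU (fib_cartesian f h : @gcartesian _ _ _ F _ _ _ _ _)).
transitivity (tclass_on (fib2 f h : gmap F U) tU (\bigcup_(i in `I_d) A i)).
  by apply/esym/tclass_onT => z; have [i [w [id <-]]] := ecov z; exists i => //; exists w.
rewrite tclass_on_sum //; last first.
  move=> i j _ id jd [w _ <-] [v _ /(congr1 sval) /= [vw1 vw2]].
  exact: (Ldis i j w v).
apply: eq_bigr => i _; have id := ltn_ord i.
pose u : gmap (leg_src (L i)) (subF (A i)) :=
  @corestrict _ _ (A i) _ (e i) (fun w => ex_intro2 _ _ w I erefl).
rewrite /tclass_on -(tclass_source (i := u)).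
- exact: tclass_ext.
- by move=> w v /(congr1 sval) /= /(congr1 sval) /= [wv1 wv2]; exact: (Linj i).
- move=> z; have [w _ wz] : A i (sval z) by exact: sub_val.
  by exists w; exact: sub_carP.
Qed.

(** Additivity reduces any property that is stable under sums to the restrictions
    of f to the orbits of its source. *)
Lemma tclass_orbits (K : Theta X -> Prop) S T (f : gmap S T) tT :
  K 0 -> (forall x y, K x -> K y -> K (x + y)) ->
  (forall A : set S, gtransitive (subF A) -> K (tclass_on f tT A)) -> K (tclass f tT).
Proof.
move=> K0 KD Korb.
have /finite_seqP[os osE] : finite_set (range (@gorbit X S)) := @fgsetP _ S.
(* Orbits are added one by one. *)
pose B (l : seq (set S)) : set S := [set s | gorbit s \in l].
have Bi l : ginvariant (B l).
  by move=> g s; rewrite /B /= (gorbit_eq (s := s) (t := gact g s))//; exists g.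
rewrite -(@tclass_onT _ _ f tT (B os)); last first.
  move=> s; suff : [set` os] (gorbit s) by [].
  by rewrite -osE; exists s.
have : {subset os <= os} by [].
elim: {-2}os => [|o l IHl] los.
  by rewrite tclass_on0 // => s; rewrite /B /= in_nil.
have Kl : K (tclass_on f tT (B l)) by apply: IHl => o' o'l; apply: los; rewrite inE o'l orbT.
have [ol|nol] := boolP (o \in l).
  rewrite (_ : B (o :: l) = B l) //; apply/seteqP; split=> s; rewrite /B /= inE.
    by case/orP=> // /eqP ->.
  by move=> ->; rewrite orbT.
have : [set` os] o by apply: los; rewrite mem_head.
rewrite -osE => -[s0 _ s0o].
have oi : ginvariant o by rewrite -s0o => g _ [h _ <-]; exists (g * h)%g => //; exact: gactM.
have oE s : o s -> gorbit s = o by rewrite -s0o => /gorbit_eq.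
have -> : B (o :: l) = o `|` B l.
  apply/seteqP; split=> s; rewrite /B /= inE.
    by case/orP=> [/eqP <-|]; [left; exact: gorbit_refl|right].
  by case=> [/oE ->|->]; rewrite ?eqxx ?orbT.
rewrite tclass_onU //; last by move=> s /oE so; rewrite /B /= so (negbTE nol).
apply: KD => //; apply: Korb.
have os0 g : o (gact g s0) by rewrite -s0o; exists g.
have [t0 t0s] := sub_elt oi (os0 1%g : o _).
apply: (@gtransitiveI _ _ (t0 : subF o)) => t.
have : gorbit s0 (sval t) by rewrite s0o; exact: sub_val.
move=> [g _ gt]; exists g; apply: sub_carP.
by rewrite -gt /= t0s gact1.
Qed.

End ThetaTools.

(** * Partitions and their quotients by permutations of the parts *)

Section Partitions.
Variable X : top_space.

Notation part := (surj_gset X).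

Section Labels.
Variable n : nat.

Lemma label_subproof (P : part n) x : ((sval P x).-1 < n)%N.
Proof. by have := surj_funD P x; rewrite /bracket /=; case: (sval P x). Qed.

(** The points of surj_gset take their values in 1, .., n; labels in 'I_n start
    from 0. *)
Definition label (P : part n) (x : X) : 'I_n := Ordinal (label_subproof P x).

Lemma labelE (P : part n) x : sval P x = (label P x).+1.
Proof. by have := surj_funD P x; rewrite /bracket /=; case: (sval P x). Qed.

Lemma partP (P Q : part n) : label P =1 label Q -> P = Q.
Proof. by move=> PQ; apply/surj_funP/funext => x; rewrite !labelE PQ. Qed.

Lemma label_clopen (P : part n) : clopen_fibers (label P).
Proof.
move=> i; rewrite (_ : _ @^-1` _ = sval P @^-1` [set i.+1]).
  exact: surj_fun_clopen.
apply/seteqP; split=> x /=; rewrite labelE; first by move=> ->.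
by move=> /eq_add_S/ord_inj.
Qed.

Lemma label_onto (P : part n) i : exists x, label P x = i.
Proof.
have : bracket n i.+1 by rewrite /bracket /=.
rewrite -(svalP P).2 => -[x _ Px]; exists x; apply: ord_inj.
by move: Px; rewrite labelE => -[].
Qed.

Lemma label_act g (P : part n) x : label (gact g P) x = label P (hinv g x).
Proof. exact: ord_inj. Qed.

Lemma part_of_subproof (Z : X -> 'I_n) :
  clopen_fibers Z -> (forall i, exists x, Z x = i) ->
  continuous (fun x => (Z x).+1) /\ range (fun x => (Z x).+1) = bracket n.
Proof.
move=> Zc Zs; split.
  apply/continuousP => A _.
  by have [] := clopen_fibers_preimage ((fun i : 'I_n => i.+1) @^-1` A) Zc.
apply/seteqP; split=> [_ [x _ <-]|[//|i] /= lin]; first exact: ltn_ord.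
by have [x Zx] := Zs (Ordinal lin); exists x => //; rewrite Zx.
Qed.

Definition part_of (Z : X -> 'I_n) (Zc : clopen_fibers Z)
  (Zs : forall i, exists x, Z x = i) : part n := exist _ _ (part_of_subproof Zc Zs).

Lemma part_ofE Z (Zc : clopen_fibers Z) (Zs : forall i, exists x, Z x = i) x :
  label (part_of Zc Zs) x = Z x.
Proof. exact: ord_inj. Qed.

Lemma part_exists Z :
  clopen_fibers Z -> (forall i, exists x, Z x = i) -> exists P : part n, forall x, label P x = Z x.
Proof. by move=> Zc Zs; exists (part_of Zc Zs) => x; rewrite part_ofE. Qed.

End Labels.

Section Relabel.
Variables (n m : nat) (r : 'I_n -> 'I_m) (rs : forall j, exists i, r i = j).

Lemma relabel_surj (P : part n) j : exists x, (r \o label P) x = j.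
Proof. by have [i <-] := rs j; have [x <-] := label_onto P i; exists x. Qed.

Definition relabel_fun (P : part n) : part m :=
  part_of (clopen_fibers_comp r (label_clopen P)) (relabel_surj P).

Lemma relabel_funM g P : relabel_fun (gact g P) = gact g (relabel_fun P).
Proof. by apply: partP => x; rewrite label_act !part_ofE /= label_act. Qed.

Definition relabel : gmap (part n) (part m) := GMap relabel_funM.

Lemma relabelE P x : label (relabel P) x = r (label P x).
Proof. exact: part_ofE. Qed.

End Relabel.

Lemma perm_surj n (s : 'S_n) j : exists i, s i = j.
Proof. by exists ((s^-1)%g j); rewrite permKV. Qed.

Definition pperm n (s : 'S_n) : gmap (part n) (part n) :=
  relabel (perm_surj s).

Lemma pperm1 n (P : part n) : pperm 1%g P = P.
Proof. by apply: partP => x; rewrite relabelE perm1. Qed.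

Lemma ppermM n (s t : 'S_n) (P : part n) : pperm (s * t)%g P = pperm t (pperm s P).
Proof. by apply: partP => x; rewrite !relabelE permM. Qed.

Lemma ppermI n (s t : 'S_n) (P : part n) : pperm s P = pperm t P -> s = t.
Proof.
move=> st; apply/permP => i; have [x <-] := label_onto P i.
by rewrite -!(relabelE (perm_surj _)) -/(pperm s) -/(pperm t) st.
Qed.

Section Quotient.
Variables (n : nat) (G : {group 'S_n}).

Definition porbit (P : part n) : set (part n) :=
  [set Q | exists2 s, s \in G & Q = pperm s P].

Lemma porbitP P Q : porbit P = porbit Q <-> exists2 s, s \in G & Q = pperm s P.
Proof.
split=> [PQ|[s sG ->]].
  suff : porbit P Q by [].
  by rewrite PQ; exists 1%g; rewrite ?group1 ?pperm1.
apply/seteqP; split=> _ [t tG ->].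
  exists (s^-1 * t)%g; first by rewrite groupM ?groupV.
  by rewrite -ppermM mulKVg.
by exists (s * t)%g; rewrite ?groupM ?ppermM.
Qed.

Lemma porbit_act g P : gact g @` porbit P = porbit (gact g P).
Proof.
apply/seteqP; split=> [_ [_ [s sG ->] <-]|_ [s sG ->]].
  by exists s => //; rewrite gfunM.
by exists (pperm s P); rewrite ?gfunM //; exists s.
Qed.

(** Classes are predicates rather than sets, since the type of sets is too large
    for the carrier of a G-set. *)
Definition quot := {A : part n -> Prop | exists P, A = porbit P}.

Lemma quotP (A B : quot) : sval A = sval B -> A = B.
Proof.
case: A B => [A Ap] [B Bp] /= AB; subst B; congr exist.
exact: Prop_irrelevance.
Qed.

Lemma quot_act_subproof g (A : quot) : exists P, gact g @` sval A = porbit P.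
Proof. by case: A => A [P /= ->]; exists (gact g P); rewrite porbit_act. Qed.

Definition quot_act g (A : quot) : quot := exist _ _ (quot_act_subproof g A).

Definition quot_cls (P : part n) : quot := exist _ _ (ex_intro _ P erefl).

Lemma quot_clsM g P : quot_cls (gact g P) = quot_act g (quot_cls P).
Proof. by apply: quotP; rewrite /= porbit_act. Qed.

Lemma quot_cls_surj A : exists P, quot_cls P = A.
Proof. by case: A => A [P AP]; exists P; exact: quotP. Qed.

Lemma quot_act1 A : quot_act 1%g A = A.
Proof. by have [P <-] := quot_cls_surj A; rewrite -quot_clsM gact1. Qed.

Lemma quot_actM g h A : quot_act (g * h)%g A = quot_act g (quot_act h A).
Proof. by have [P <-] := quot_cls_surj A; rewrite -!quot_clsM gactM. Qed.

Lemma quot_smooth A : open [set g | quot_act g A = A].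
Proof.
have [P <-] := quot_cls_surj A.
by apply: (smooth_dominated quot_actM (s := P)) => g gP; rewrite -quot_clsM gP.
Qed.

Definition quot_gset : gset X := GSet quot_act1 quot_actM quot_smooth.

Definition quot_map : gmap (part n) quot_gset :=
  @GMap X (part n) quot_gset quot_cls quot_clsM.

End Quotient.

Hypothesis cX : is_cantor X.

Lemma part_transitive n (P Q : part n) : exists g, gact g P = Q.
Proof. by apply/gorbitP; rewrite surj_orbit. Qed.

Lemma part_inhabited n : (0 < n)%N -> exists P : part n, True.
Proof.
case: n => // n _.
have [|Z Zc ZT] := @exists_labeling X cX 'I_n.+1 setT; first by exists ord0.
have Zs i : exists x, Z x = i.
  by have : [set: 'I_n.+1] i by []; rewrite -ZT => -[x _ <-]; exists x.
by have [P _] := part_exists Zc Zs; exists P.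
Qed.

Lemma part_gtransitive n : (0 < n)%N -> gtransitive (part n).
Proof.
by move=> /part_inhabited[P _]; apply: (gtransitiveI (s := P)) => Q; exact: part_transitive.
Qed.

Notation partF n := (surj_fgset n cX).

Lemma quot_finitary n (G : {group 'S_n}) : finitary (quot_gset G).
Proof.
apply: (@finitary_jointly _ _ 1 (fun=> part n) (fun=> quot_map G)).
  by move=> _ _; exact: surj_finitary.
by move=> A; have [P PA] := quot_cls_surj A; exists 0%N, P.
Qed.

Definition quotF n (G : {group 'S_n}) : fgset X := FGSet (quot_finitary G).

Definition quot_by n (S : gset X) (q : gmap (part n) S) (G : {set 'S_n}) :=
  (forall s, exists P, q P = s) /\
  forall P Q, q P = q Q <-> exists2 s, s \in G & Q = pperm s P.

Lemma quot_map_by n (G : {group 'S_n}) : quot_by (quot_map G) G.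
Proof.
split=> [A|P Q]; first exact: quot_cls_surj.
rewrite -porbitP; split=> [/(congr1 sval) //|PQ]; exact: quotP.
Qed.

Lemma quot_transitive n (S : gset X) (q : gmap (part n) S) :
  (0 < n)%N -> (forall s, exists P, q P = s) -> gtransitive S.
Proof.
move=> /part_inhabited[P _] qs; apply: (gtransitiveI (s := q P)) => t.
have [Q <-] := qs t; have [g <-] := part_transitive P Q.
by exists g; rewrite gfunM.
Qed.

(** The quotient X(n) / G is only given up to isomorphism, by its map from X(n). *)
Definition is_quot_class n m (G : {set 'S_n}) (r : 'I_n -> 'I_m) (x : Theta X) :=
  exists (S : fgset X) (q : gmap (part n) S) (f : gmap S (partF m)) tm,
  [/\ quot_by q G, forall P y, label (f (q P) : part m) y = r (label P y) & x = tclass f tm].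

Definition quot_class n m (G : {set 'S_n}) (r : 'I_n -> 'I_m) : Theta X :=
  xget 0 [set x | is_quot_class G r x].

Lemma is_quot_class_unique n m (G : {set 'S_n}) (r : 'I_n -> 'I_m) x y :
  is_quot_class G r x -> is_quot_class G r y -> x = y.
Proof.
move=> [S [q [f [tm [[qs qG] fr ->]]]]] [S' [q' [f' [tm' [[q's q'G] f'r ->]]]]].
have [e eq'] : exists e : gmap S S', forall P, e (q P) = q' P.
  by apply: gmap_factor => // P Q /qG/q'G.
have fe : f =1 gcomp f' e.
  by move=> s; have [P <-] := qs s; apply: partP => z; rewrite /= fr eq' f'r.
rewrite (tclass_ext tm fe) (Prop_irrelevance tm tm'); apply: tclass_source.
  move=> s t; have [P <-] := qs s; have [Q <-] := qs t.
  by rewrite !eq' => /q'G/qG.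
by move=> t; have [P <-] := q's t; exists (q P).
Qed.

Lemma quot_classE n m (G : {set 'S_n}) (r : 'I_n -> 'I_m) x :
  is_quot_class G r x -> quot_class G r = x.
Proof.
by move=> rx; apply: (is_quot_class_unique _ rx); exact: xgetI rx.
Qed.

(** The symmetries of the fibers of r: the largest group by which X(n) can be
    divided over X(m). *)
Definition fixg n m (r : 'I_n -> 'I_m) : {set 'S_n} :=
  [set s : 'S_n | [forall i, r (s i) == r i]].

Lemma fixgP n m (r : 'I_n -> 'I_m) (s : 'S_n) :
  reflect (forall i, r (s i) = r i) (s \in fixg r).
Proof. by rewrite inE; exact: 'forall_eqP. Qed.

Lemma fixg_group_set n m (r : 'I_n -> 'I_m) : group_set (fixg r).
Proof.
apply/group_setP; split; first by apply/fixgP => i; rewrite perm1.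
move=> s t /fixgP sr /fixgP tr; apply/fixgP => i.
by rewrite permM tr sr.
Qed.

Canonical fixg_group n m (r : 'I_n -> 'I_m) := Group (fixg_group_set r).

Lemma quot_classP n m (G : {group 'S_n}) (r : 'I_n -> 'I_m) :
  (0 < m)%N -> (forall j, exists i, r i = j) -> G \subset fixg r ->
  is_quot_class G r (quot_class G r).
Proof.
move=> m0 rs /fintype.subsetP Gr.
have [f fq] : exists f : gmap (quot_gset G) (partF m), forall P,
    f (quot_map G P) = relabel rs P.
  have [qs qG] := quot_map_by G.
  apply: gmap_factor => // P Q /qG[s /Gr/fixgP sr ->].
  by apply: partP => x; rewrite !relabelE sr.
suff rx : is_quot_class G r (tclass (f : gmap (quotF G) _) (part_gtransitive m0)).
  by rewrite (quot_classE rx).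
exists (quotF G), (quot_map G), f, (part_gtransitive m0); split=> //.
  exact: quot_map_by.
by move=> P y; rewrite fq relabelE.
Qed.

End Partitions.

(** * Index formula and base change for quotients of partition sets *)

Definition onto (A B : Type) (r : A -> B) := forall b, exists a, r a = b.

Lemma onto_factor (A B C : Type) (f : A -> B) (g : A -> C) :
  onto f -> (forall x y, f x = f y -> g x = g y) -> exists h, forall x, h (f x) = g x.
Proof.
move=> /choice[c cK] fg; exists (g \o c) => x /=.
by apply: fg; rewrite cK.
Qed.

Lemma onto_comp (A B C : Type) (f : A -> B) (g : B -> C) : onto f -> onto g -> onto (g \o f).
Proof. by move=> fs gs c; have [b <-] := gs c; have [a <-] := fs b; exists a. Qed.

Lemma onto_inj n (f : 'I_n -> 'I_n) : onto f -> injective f.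
Proof.
move=> /choice[c cK]; have cinj : injective c by exact: can_inj cK.
by move=> x y; rewrite -(f_invF cinj x) -(f_invF cinj y) !cK => ->.
Qed.

Lemma onto_gt0 n m (f : 'I_n -> 'I_m) : onto f -> (0 < m)%N -> (0 < n)%N.
Proof.
case: m f => // m f fs _; have [i _] := fs ord0.
exact: leq_ltn_trans (leq0n i) (ltn_ord i).
Qed.

Section Classes.
Variables (X : top_space) (cX : is_cantor X).
Notation part := (surj_gset X).
Notation partF n := (surj_fgset n cX).
Notation quot_class := (quot_class cX).
Notation is_quot_class := (is_quot_class cX).

(** Over X(n), the map X(n)/G -> X(n)/D becomes a disjoint union of copies
    of the base: each left coset d G in D gives the section that sends P to the
    class of d P. *)
Lemma quot_class_index n m (r : 'I_n -> 'I_m) (G D : {group 'S_n}) :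
  (0 < m)%N -> onto r -> D \subset fixg r -> G \subset D ->
  quot_class G r = (#|D : G|)%g%:R * quot_class D r.
Proof.
move=> m0 rs Dr GD; have n0 := onto_gt0 rs m0.
have [S [q [f [tm [[qs qG] fr ->]]]]] := quot_classP cX m0 rs (fintype.subset_trans GD Dr).
have [T [q' [f' [tm' [[q's q'D] f'r ->]]]]] := quot_classP cX m0 rs Dr.
have [e eq'] : exists e : gmap S T, forall P, e (q P) = q' P.
  apply: gmap_factor => // P Q /qG[s sG ->]; apply/q'D; exists s => //.
  exact: (fintype.subsetP GD).
have tT := quot_transitive cX n0 q's.
have fe : f =1 gcomp f' e.
  by move=> s; have [P <-] := qs s; apply: partP => z; rewrite /= fr eq' f'r.
rewrite (tclass_ext tm fe) (tclass_comp _ _ tT) (Prop_irrelevance tm tm') mulrC; congr (_ * _).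
(* Representatives of the cosets; the default coset G keeps d k in D for all k. *)
pose d k : 'S_n := repr (nth (G : {set 'S_n}) (enum (lcosets G D)) k).
have dD k : d k \in D.
  have [kl|lk] := ltnP k (size (enum (lcosets G D))).
    have : nth (G : {set 'S_n}) (enum (lcosets G D)) k \in lcosets G D.
      by rewrite -mem_enum mem_nth.
    rewrite /d => /lcosetsP[x xD ->].
    have /lcosetP[g gG ->] : repr ((x *: G)%g) \in (x *: G)%g.
      by rewrite (mem_repr _ (lcoset_refl _ _)).
    by rewrite groupM // (fintype.subsetP GD).
  by rewrite /d nth_default // (fintype.subsetP GD) // (mem_repr _ (group1 G)).
pose L k : leg S (partF n) := Leg (leg_src := partF n) (gcomp q (pperm X (d k))) (gid _).
have szE : size (enum (lcosets G D)) = (#|D : G|)%g by rewrite -cardE card_lcosets.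
rewrite (@tclass_legs X S T (partF n) e q' tT (part_gtransitive cX n0) (#|D : G|)%g L).
- rewrite (eq_bigr (fun=> 1)) => [|i _]; first by rewrite sumr_const card_ord.
  by apply: tclass_iso; exists (gid _); split.
- move=> i P; rewrite /= eq'; apply/esym/q'D; exists (d i) => //; exact: dD.
- by [].
- move=> i j P Q id jd /= + PQ; rewrite PQ => /qG[s sG].
  rewrite -ppermM => /ppermI ji; apply/eqP.
  rewrite -szE in id jd; rewrite -(nth_uniq (G : {set 'S_n}) id jd) ?enum_uniq //; apply/eqP.
  have cos k : (k < size (enum (lcosets G D)))%N ->
      nth (G : {set 'S_n}) (enum (lcosets G D)) k = (d k *: G)%g.
    move=> kl; have : nth (G : {set 'S_n}) (enum (lcosets G D)) k \in lcosets G D.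
      by rewrite -mem_enum mem_nth.
    rewrite /d => /lcosetsP[x xD ->]; apply/lcoset_eqP.
    by rewrite lcoset_sym (mem_repr _ (lcoset_refl _ _)).
  by rewrite !cos // ji; apply/esym/lcoset_eqP; rewrite mem_lcoset mulKg.
- move=> s P; have [Q <-] := qs s; rewrite eq' => /esym/q'D[t tD ->].
  have tl : (t *: G)%g \in enum (lcosets G D) by rewrite mem_enum; apply/lcosetsP; exists t.
  exists (index (t *: G)%g (enum (lcosets G D))), P; split=> //.
    by rewrite -szE index_mem.
  apply/qG; rewrite /= /d nth_index //.
  have /lcosetP[g gG ->] : repr (t *: G)%g \in (t *: G)%g.
    by rewrite (mem_repr _ (lcoset_refl _ _)).
  exists (g^-1)%g; rewrite ?groupV //.
  by rewrite -[RHS](ppermM (t * g)%g (g^-1)%g P) mulgK.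
Qed.

(** Since every element of H lifts to G, two classes over the same
    point of X(m)/H have representatives P and Q with r P = Q, and P is unique up to
    the elements of G that fix the fibers of r. So X(n)/(G :&: fixg r) is the fiber
    product of X(n)/G and X(m) over X(m)/H. *)
Lemma quot_class_base_change n m k (r : 'I_n -> 'I_m) (p : 'I_m -> 'I_k)
    (G : {group 'S_n}) (H : {group 'S_m}) :
  (0 < k)%N -> onto r -> onto p -> G \subset fixg (p \o r) ->
  (forall s, s \in G -> exists2 t, t \in H & forall i, r (s i) = t (r i)) ->
  (forall t, t \in H -> exists2 s, s \in G & forall i, r (s i) = t (r i)) ->
  quot_class G (p \o r) = quot_class H p * quot_class (G :&: fixg r)%g r.
Proof.
move=> k0 rs ps Gpr GH HG.
have m0 := onto_gt0 ps k0; have n0 := onto_gt0 rs m0.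
have Hp : H \subset fixg p.
  apply/fintype.subsetP => t /HG[s /(fintype.subsetP Gpr)/fixgP sG st].
  by apply/fixgP => j; have [i <-] := rs j; rewrite -st; exact: sG.
have [S [q [f [tm [[qs qG] fr ->]]]]] := quot_classP cX k0 (onto_comp rs ps) Gpr.
have [T [q' [f' [tm' [[q's q'H] f'r ->]]]]] := quot_classP cX k0 ps Hp.
have [|V [v [w [tV [[vs vG] wr ->]]]]] := @quot_classP X cX _ _ (G :&: fixg r)%G r m0 rs.
  exact: subsetIr.
have tT := quot_transitive cX m0 q's.
have [e eE] : exists e : gmap S T, forall P, e (q P) = q' (relabel X rs P).
  apply: (gmap_factor (r := gcomp q' (relabel X rs))) => // P Q /qG[s sG ->] /=.
  have [t tH st] := GH s sG; apply/q'H; exists t => //.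
  by apply: partP => x; rewrite !relabelE st.
have fe : f =1 gcomp f' e.
  move=> s; have [P <-] := qs s; apply: partP => z.
  by rewrite /= fr eE f'r relabelE.
rewrite (tclass_ext tm fe) (tclass_comp _ _ tT) (Prop_irrelevance tm tm'); congr (_ * _).
have [u uE] : exists u : gmap V S, forall P, u (v P) = q P.
  apply: gmap_factor => // P Q /vG[s /setIP[sG _] ->]; apply/qG; exists s => //.
have wE P : w (v P) = relabel X rs P by apply: partP => x; rewrite wr relabelE.
apply/esym; apply: (tclass_base_change _ _ (q := (q' : gmap (partF m) T)) (q' := u)); split.
  by move=> z; have [P <-] := vs z; rewrite uE eE wE.
move=> s Q; have [P <-] := qs s; rewrite eE => /q'H[t /HG[g gG gt] QE].
have QgP : Q = relabel X rs (pperm X g P).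
  by rewrite QE; apply: partP => x; rewrite !relabelE gt.
exists (v (pperm X g P)); split.
  by rewrite uE wE; split=> //; apply/esym/qG; exists g.
move=> z; have [P' <-] := vs z; rewrite uE wE => -[qP' rP'].
have : q (pperm X g P) = q P' by rewrite qP'; apply/esym/qG; exists g.
move=> /qG[h hG P'E]; apply/vG; exists h => //; rewrite inE hG; apply/fixgP => i.
have [x <-] := label_onto (pperm X g P) i.
rewrite -(relabelE (perm_surj h)) -/(pperm X h) -P'E -(relabelE rs) rP' QgP.
by rewrite relabelE.
Qed.

Lemma quot_class1E n m (r : 'I_n -> 'I_m) (rs : onto r) (m0 : (0 < m)%N) :
  quot_class 1%g r = tclass (relabel X rs : gmap (partF n) (partF m)) (part_gtransitive cX m0).
Proof.
apply: quot_classE; exists (partF n), (gid _), (relabel X rs), (part_gtransitive cX m0).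
split=> //; last by move=> P y; rewrite relabelE.
split=> [P|P Q]; first by exists P.
split=> [PQ|[s /set1P -> ->]]; last by rewrite pperm1.
by exists 1%g; rewrite ?group1 ?pperm1.
Qed.

Lemma quot_class_inj n m (r : 'I_n -> 'I_m) :
  (0 < m)%N -> onto r -> injective r -> quot_class 1%g r = 1.
Proof.
move=> m0 rs rinj; rewrite (quot_class1E rs m0); apply: tclass_iso; apply: giso_bij.
  move=> P Q PQ; apply: partP => x; apply: rinj.
  by rewrite -!(relabelE rs) PQ.
move=> Q; have [c cK] := choice rs.
have [|P PE] := part_exists (clopen_fibers_comp c (label_clopen Q)).
  move=> i; have [x Qx] := label_onto Q (r i); exists x.
  by apply: rinj; rewrite /= cK Qx.
by exists P; apply: partP => x; rewrite relabelE PE /= cK.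
Qed.

Lemma quot_class_comp n m k (r : 'I_n -> 'I_m) (p : 'I_m -> 'I_k) :
  (0 < k)%N -> onto r -> onto p ->
  quot_class 1%g (p \o r) = quot_class 1%g p * quot_class 1%g r.
Proof.
move=> k0 rs ps; have -> := @quot_class_base_change _ _ _ r p 1%G 1%G k0 rs ps.
- by congr (_ * quot_class _ _); apply/finset.setIidPl; exact: sub1G.
- exact: sub1G.
- by move=> s /set1P ->; exists 1%g => // i; rewrite !perm1.
- by move=> s /set1P ->; exists 1%g => // i; rewrite !perm1.
Qed.

Lemma quot_class_eq n m (G : {set 'S_n}) (r r' : 'I_n -> 'I_m) :
  r =1 r' -> quot_class G r = quot_class G r'.
Proof. by move=> /funext ->. Qed.

(** The last hypothesis says that only one pattern occurs: each
    pair of labels (s z, k z) is the only pair with one of its two entries, so it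
    occurs in every point of the fiber product, which is thus again a set of
    partitions. *)
Lemma quot_class_pullback a b c l (r : 'I_a -> 'I_c) (t : 'I_b -> 'I_c)
    (s : 'I_l -> 'I_a) (k : 'I_l -> 'I_b) :
  (0 < c)%N -> onto r -> onto t -> onto s -> onto k ->
  (forall z, r (s z) = t (k z)) ->
  (forall z w, s z = s w -> k z = k w -> z = w) ->
  (forall u v, r u = t v -> exists z, s z = u /\ k z = v) ->
  (forall z, (forall w, s w = s z -> w = z) \/ (forall w, k w = k z -> w = z)) ->
  quot_class 1%g r = quot_class 1%g k.
Proof.
move=> c0 rs ts ss ks rstk inj cov forced; have b0 := onto_gt0 ts c0.
rewrite (quot_class1E rs c0) (quot_class1E ks b0).
apply/esym; apply: (tclass_base_change _ _ (q := (relabel X ts : gmap (partF b) (partF c)))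
  (q' := (relabel X ss : gmap (partF l) (partF a)))); split.
  by move=> Z; apply: partP => x; rewrite !relabelE rstk.
move=> P Q PQ.
have labPQ x : exists z, s z = label P x /\ k z = label Q x.
  by apply: cov; rewrite -(relabelE rs) PQ relabelE.
have [ph phE] : exists ph : 'I_a * 'I_b -> 'I_l, forall z, ph (s z, k z) = z.
  have l0 := onto_gt0 ss (onto_gt0 rs c0).
  exists (fun uv => if [pick z | (s z == uv.1) && (k z == uv.2)] is Some z then z
    else Ordinal l0) => z.
  case: pickP => [w /andP[/eqP sw /eqP kw]|/(_ z)]; first exact: inj.
  by rewrite /= !eqxx.
have [|Z ZE] := part_exists (clopen_fibers_comp ph
  (clopen_fibers_pair (label_clopen P) (label_clopen Q))).
  move=> z; case: (forced z) => zw.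
    have [x Px] := label_onto P (s z); exists x; have [w [sw kw]] := labPQ x.
    by rewrite /= -sw -kw phE; apply: zw; rewrite sw.
  have [x Px] := label_onto Q (k z); exists x; have [w [sw kw]] := labPQ x.
  by rewrite /= -sw -kw phE; apply: zw; rewrite kw.
have ZP x : s (label Z x) = label P x /\ k (label Z x) = label Q x.
  by rewrite ZE /=; have [w [sw kw]] := labPQ x; rewrite -sw -kw phE.
exists Z; split.
  by split; apply: partP => x; rewrite relabelE; case: (ZP x).
move=> W [WP WQ]; apply: partP => x; have [sZ kZ] := ZP x.
by apply: inj; rewrite ?sZ ?kZ -?WP -?WQ relabelE.
Qed.

End Classes.

(** * Cutting one part in two *)

(** The last label is a new half of the part c, and ext c glues it back. *)
Definition ext k (c : 'I_k) (x : 'I_k.+1) : 'I_k :=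
  if unlift ord_max x is Some y then y else c.

Local Notation old := (lift ord_max).

Lemma ext_old k (c y : 'I_k) : ext c (old y) = y.
Proof. by rewrite /ext liftK. Qed.

Lemma ext_new k (c : 'I_k) : ext c ord_max = c.
Proof. by rewrite /ext unlift_none. Qed.

Lemma ext_onto k (c : 'I_k) : onto (ext c).
Proof. by move=> y; exists (old y); rewrite ext_old. Qed.

Lemma old_inj k : injective (old : 'I_k -> 'I_k.+1).
Proof. exact: lift_inj. Qed.

Lemma old_neq k (y : 'I_k) : old y != ord_max.
Proof. by rewrite eq_sym neq_lift. Qed.

Lemma ord_oldP k (P : 'I_k.+1 -> Prop) :
  (forall y, P (old y)) -> P ord_max -> forall x, P x.
Proof. by move=> Po Pm x; case: (unliftP ord_max x) => [y ->|->]. Qed.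

Lemma split_pair k (r : 'I_k.+1 -> 'I_k) : exists a b, a != b /\ r a = r b.
Proof.
apply: contrapT => nr; suff /leq_card : injective r by rewrite !card_ord ltnn.
move=> a b rab; apply/eqP/negPn/negP => ab; apply: nr; by exists a, b.
Qed.

(** Without the label a, r is still surjective, hence bijective by counting. *)
Lemma split_kernel k (r : 'I_k.+1 -> 'I_k) a b : onto r -> a != b -> r a = r b ->
  forall x y, r x = r y -> [\/ x = y, x = a /\ y = b | x = b /\ y = a].
Proof.
move=> rs ab rab.
have sinj : injective (r \o lift a).
  apply: onto_inj => j; have [i <-] := rs j.
  case: (unliftP a i) => [i' ->|->]; first by exists i'.
  by rewrite rab; have [b' ->] := unlift_some ab; exists b'.
have rinj x y : x != a -> y != a -> r x = r y -> x = y.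
  by rewrite (eq_sym x) (eq_sym y) => /unlift_some[x' -> _] /unlift_some[y' -> _] /sinj ->.
move=> x y; have [->|xa] := eqVneq x a; have [->|ya] := eqVneq y a.
- by constructor 1.
- by rewrite rab => /rinj -> //; [constructor 2|rewrite eq_sym].
- by rewrite rab => /rinj -> //; [constructor 3|rewrite eq_sym].
- by move=> /rinj -> //; constructor 1.
Qed.

Lemma perm_pair n (a b a' b' : 'I_n) : a != b -> a' != b' ->
  exists s : 'S_n, s a' = a /\ s b' = b.
Proof.
move=> ab a'b'; set c := tperm a' a b'.
have ca : c != a.
  apply/eqP => e; move/eqP: a'b'; apply; apply: (@perm_inj _ (tperm a' a)).
  by rewrite tpermL -/c e.
exists (tperm a' a * tperm c b)%g; rewrite !permM -/c !tpermL tpermD //.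
by rewrite eq_sym.
Qed.

Lemma fixg_split k (r : 'I_k.+1 -> 'I_k) a b (s : 'S_k.+1) :
  onto r -> a != b -> r a = r b -> s \in fixg r -> s = 1%g \/ s = tperm a b.
Proof.
move=> rs ab rab /fixgP sr; have ker x := split_kernel rs ab rab (sr x).
have sx x : x != a -> x != b -> s x = x.
  by move=> xa xb; case: (ker x) => // -[_ /eqP]; rewrite ?(negbTE xa) ?(negbTE xb).
case: (ker a) => [sa|[_ /eqP]|[sa _]]; last 2 first.
- by rewrite (negbTE ab).
- have sb : s b = a.
    case: (ker b) => [sb|[//]|[_ /eqP]]; last by rewrite eq_sym (negbTE ab).
    by move/eqP: ab; case; apply: (@perm_inj _ s); rewrite sa sb.
  right; apply/permP => x; case: tpermP => [->|->|xa xb] //.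
  by apply: sx; exact/eqP.
left; apply/permP => x; rewrite perm1.
have [->//|xa] := eqVneq x a; have [->|xb] := eqVneq x b; last exact: sx.
case: (ker b) => [//|[sb _]|[_ /eqP]]; last by rewrite eq_sym (negbTE ab).
by move/eqP: ab; case; apply: (@perm_inj _ s); rewrite sa sb.
Qed.

Lemma tperm_fixg n m (r : 'I_n -> 'I_m) a b : r a = r b -> tperm a b \in fixg r.
Proof. by move=> rab; apply/fixgP => x; case: tpermP => [->|->|]. Qed.

Section Splits.
Variables (X : top_space) (cX : is_cantor X).
Notation part := (surj_gset X).
Notation partF n := (surj_fgset n cX).
Notation quot_class := (quot_class cX).

(** The class of X(k+2) -> X(k+1), for any way of cutting one part in two. *)
Definition split_class k := quot_class 1%g (ext (ord0 : 'I_k.+1)).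

(** Two surjections from k+2 to k+1 labels differ by renaming the labels of the
    source and of the target. *)
Lemma quot_class_split k (r : 'I_k.+2 -> 'I_k.+1) :
  onto r -> quot_class 1%g r = split_class k.
Proof.
move=> rs; pose r0 := ext (ord0 : 'I_k.+1); have r0s : onto r0 by exact: ext_onto.
have [a [b [ab rab]]] := split_pair r0; have [a' [b' [ab' rab']]] := split_pair r.
have [s [sa sb]] := perm_pair ab ab'.
have ss : onto s by move=> j; exists ((s^-1)%g j); rewrite permKV.
have r0ss : onto (r0 \o s) by exact: onto_comp.
have [|h hE] := @onto_factor _ _ _ (r0 \o s) r r0ss.
  move=> x y /(split_kernel r0s ab rab) []; first by move/perm_inj ->.
    by rewrite -sa -sb => -[/perm_inj -> /perm_inj ->].
  by rewrite -sa -sb => -[/perm_inj -> /perm_inj ->].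
have hs : onto h by move=> j; have [x <-] := rs j; rewrite -hE; exists ((r0 \o s) x).
rewrite /split_class -/r0 -(@quot_class_eq _ _ _ _ _ (h \o (r0 \o s)) r hE).
rewrite (@quot_class_comp _ cX _ _ _ (r0 \o s) h) // (@quot_class_comp _ cX _ _ _ s r0) //.
rewrite (quot_class_inj cX _ hs (onto_inj hs)) // mul1r.
by rewrite (quot_class_inj cX _ ss (@perm_inj _ s)) // mulr1.
Qed.

(** Cutting a part a and cutting another part b can be done independently, so
    one map is the base change of the other; two parts are needed, whence the
    shift of the index. *)
Lemma split_class_const k : split_class k.+2 = split_class k.+1.
Proof.
pose a : 'I_k.+2 := ord0; pose b : 'I_k.+2 := ord_max; have ab : a != b by [].
rewrite -(quot_class_split (ext_onto a)) -(quot_class_split (ext_onto (old a))).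
(* The last label of 'I_k.+4 is the new half of a and the last but one is the
   new half of b; s undoes the cut of b
   and ext (old a) undoes the cut of a. *)
pose s (z : 'I_k.+4) : 'I_k.+3 :=
  if unlift ord_max z is Some w then old (ext b w) else ord_max.
have s_old w : s (old w) = old (ext b w) by rewrite /s liftK.
have s_new : s ord_max = ord_max by rewrite /s unlift_none.
apply/esym; apply: (@quot_class_pullback X cX _ _ _ _ _ (ext b) s) => //; try exact: ext_onto.
- elim/ord_oldP=> [y|]; last by exists ord_max.
  by exists (old (old y)); rewrite s_old ext_old.
- by elim/ord_oldP=> [w|]; rewrite ?s_old ?s_new ?ext_new !ext_old // ext_old.
- elim/ord_oldP=> [w|]; elim/ord_oldP=> [w'|]; rewrite ?s_old ?s_new ?ext_old ?ext_new //.
  + by move=> _ ->.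
  + by move=> /eqP; rewrite (negbTE (old_neq _)).
  + by move=> /esym/eqP; rewrite (negbTE (old_neq _)).
- elim/ord_oldP=> [u|]; elim/ord_oldP=> [v|]; rewrite ?ext_old ?ext_new.
  + by move=> ->; exists (old (old v)); rewrite s_old !ext_old.
  + by move=> ->; exists (old ord_max); rewrite s_old ext_old ext_new.
  + by move=> <-; exists ord_max; rewrite s_new ext_new.
  + by move=> /eqP; rewrite (negbTE ab).
- elim/ord_oldP=> [w|]; last first.
    left; elim/ord_oldP=> [w|//]; rewrite s_old s_new => /eqP.
    by rewrite (negbTE (old_neq _)).
  have [->|wa] := eqVneq w (old a).
    left; elim/ord_oldP=> [w'|]; rewrite !s_old ext_old ?s_new.
      move=> /old_inj; elim/ord_oldP: w' => [y|]; rewrite ?ext_old ?ext_new; first by move->.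
      by move=> /eqP; rewrite eq_sym (negbTE ab).
    by move=> /esym/eqP; rewrite (negbTE (old_neq _)).
  right; elim/ord_oldP=> [w'|]; rewrite ext_old ?ext_old ?ext_new; first by move->.
  by move=> /esym/eqP; rewrite (negbTE wa).
Qed.

End Splits.

(** * The quadratic relation *)

Section SplitRelation.
Variables (X : top_space) (cX : is_cantor X).
Notation part := (surj_gset X).
Notation partF n := (surj_fgset n cX).
Notation quot_class := (quot_class cX).

Variables (k : nat) (r : 'I_k.+2 -> 'I_k.+1) (a b : 'I_k.+2).
Hypotheses (rs : onto r) (ab : a != b) (rab : r a = r b).

Let ba : b != a. Proof. by rewrite eq_sym. Qed.

(** Let P and Q cut the same part of a partition, P into unordered halves.
    If P leaves the half a of Q whole but cuts the half b, the labels of the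
    common refinement are those of Q and a new one for the rest of b. On them, ext
    b is the label in Q and flip1 is the label in P, where a and the first half of
    b form one half of P. *)
Definition flip1 (w : 'I_k.+3) : 'I_k.+2 :=
  if unlift ord_max w is Some y then (if y == b then a else y) else b.

(** If P cuts both halves a and b of Q, the common refinement has two new
    labels: old ord_max is a second half of a, and ord_max is a second half of b.
    The label in P is given by flip2, and the label in Q by proj2 below. *)
Definition flip2 (z : 'I_k.+4) : 'I_k.+2 :=
  if unlift ord_max z is Some w then flip1 w else b.

Lemma flip1_old y : flip1 (old y) = if y == b then a else y.
Proof. by rewrite /flip1 liftK. Qed.

Lemma flip1_new : flip1 ord_max = b.
Proof. by rewrite /flip1 unlift_none. Qed.

Lemma flip2_old w : flip2 (old w) = flip1 w.
Proof. by rewrite /flip2 liftK. Qed.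

Lemma flip2_new : flip2 ord_max = b.
Proof. by rewrite /flip2 unlift_none. Qed.

Lemma flip1_onto : onto flip1.
Proof.
move=> y; have [->|yb] := eqVneq y b; first by exists ord_max; rewrite flip1_new.
by exists (old y); rewrite flip1_old (negbTE yb).
Qed.

Lemma flip2_onto : onto flip2.
Proof. by move=> y; have [w <-] := flip1_onto y; exists (old w); rewrite flip2_old. Qed.

Definition proj2 (z : 'I_k.+4) := ext a (ext (old b) z).

Lemma proj2_onto : onto proj2.
Proof. exact: onto_comp (ext_onto (old b)) (ext_onto a). Qed.

(** Exchanging the two halves of P renames the common refinement by this
    permutation. *)
Definition double_swap : 'S_k.+4 :=
  (tperm (old (old a)) (old ord_max) * tperm (old (old b)) ord_max)%g.

Lemma double_swap_cases (P : 'I_k.+4 -> 'I_k.+4 -> Prop) :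
  P (old (old a)) (old ord_max) -> P (old ord_max) (old (old a)) ->
  P (old (old b)) ord_max -> P ord_max (old (old b)) ->
  (forall y, y != a -> y != b -> P (old (old y)) (old (old y))) ->
  forall z, P z (double_swap z).
Proof.
move=> Pa Pa' Pb Pb' Py.
have oE m (x y : 'I_m) : (old x == old y) = (x == y) by exact: (inj_eq (@old_inj m)).
have nE m (x : 'I_m) : (ord_max == old x) = false by rewrite eq_sym (negbTE (old_neq x)).
have nE' m (x : 'I_m) : (old x == ord_max) = false by exact: (negbTE (old_neq x)).
elim/ord_oldP=> [w|]; last first.
  by rewrite permM (@tpermD _ (old (old a))) ?nE' // tpermR.
elim/ord_oldP: w => [y|]; last first.
  by rewrite permM tpermR tpermD ?(oE, nE).
have [->|ya] := eqVneq y a.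
  by rewrite permM tpermL tpermD // ?(oE, nE, nE').
have [->|yb] := eqVneq y b.
  by rewrite permM (@tpermD _ (old (old a))) ?(oE, nE) // tpermL.
have ay : a != y by rewrite eq_sym. have yb' : b != y by rewrite eq_sym.
by rewrite permM !tpermD ?(oE, nE) //; exact: Py.
Qed.

Lemma flip2_double_swap z : flip2 (double_swap z) = tperm a b (flip2 z).
Proof.
move: z; apply: (double_swap_cases (P := fun z s => flip2 s =
  tperm a b (flip2 z))) => [||||y ya yb]; rewrite ?flip2_old ?flip2_new.
- by rewrite flip1_old flip1_new (negbTE ab) tpermL.
- by rewrite flip1_old flip1_new (negbTE ab) tpermR.
- by rewrite flip1_old eqxx tpermL.
- by rewrite flip1_old eqxx tpermR.
- by rewrite flip1_old (negbTE yb) tpermD // eq_sym.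
Qed.

Lemma ext_double_swap z :
  ext (old b) (double_swap z) = tperm (old a) ord_max (ext (old b) z).
Proof.
have oE m (x y : 'I_m) : (old x == old y) = (x == y) by exact: (inj_eq (@old_inj m)).
have nE m (x : 'I_m) : (ord_max == old x) = false by rewrite eq_sym (negbTE (old_neq x)).
move: z; apply: (double_swap_cases (P := fun z s => ext (old b) s =
  tperm (old a) ord_max (ext (old b) z))) => [||||y ya yb]; rewrite ?ext_old ?ext_new.
- by rewrite tpermL.
- by rewrite tpermR.
- by rewrite tpermD ?(oE, nE).
- by rewrite tpermD ?(oE, nE).
- by rewrite tpermD ?(oE, nE) // eq_sym.
Qed.

Lemma proj2_double_swap z : proj2 (double_swap z) = proj2 z.
Proof.
by rewrite /proj2 ext_double_swap; case: tpermP => [->|->|//]; rewrite ext_old ext_new.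
Qed.

Lemma flip1_inj w w' : flip1 w = flip1 w' -> ext b w = ext b w' -> w = w'.
Proof.
elim/ord_oldP: w => [y|]; elim/ord_oldP: w' => [y'|];
  rewrite ?flip1_old ?flip1_new ?ext_old ?ext_new // => e1 e2; rewrite ?e2 //.
  by move: e1; rewrite e2 eqxx => /eqP; rewrite (negbTE ab).
by move: e1; rewrite -e2 eqxx => /esym/eqP; rewrite (negbTE ab).
Qed.

Lemma flip2_inj z z' : flip2 z = flip2 z' -> proj2 z = proj2 z' -> z = z'.
Proof.
elim/ord_oldP: z => [w|]; elim/ord_oldP: z' => [w'|];
  rewrite /proj2 ?flip2_old ?flip2_new ?ext_old ?ext_new //.
- elim/ord_oldP: w => [y|]; elim/ord_oldP: w' => [y'|];
    rewrite ?flip1_old ?flip1_new ?ext_old ?ext_new //.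
  + by move=> _ ->.
  + by move=> + ya; rewrite ya (negbTE ab) => /eqP; rewrite (negbTE ab).
  + by move=> + ya; rewrite -ya (negbTE ab) => /esym/eqP; rewrite (negbTE ab).
- elim/ord_oldP: w => [y|]; rewrite ?flip1_old ?flip1_new ?ext_old ?ext_new.
    by move=> + yb; rewrite yb eqxx => /eqP; rewrite (negbTE ab).
  by move=> _ /eqP; rewrite (negbTE ab).
- elim/ord_oldP: w' => [y|]; rewrite ?flip1_old ?flip1_new ?ext_old ?ext_new.
    by move=> + yb; rewrite -yb eqxx => /esym/eqP; rewrite (negbTE ab).
  by move=> _ /esym/eqP; rewrite (negbTE ab).
Qed.

Lemma double_swapK z : double_swap (double_swap z) = z.
Proof. by apply: flip2_inj; rewrite ?proj2_double_swap // !flip2_double_swap tpermK. Qed.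

Lemma double_swap2 : (double_swap * double_swap = 1)%g.
Proof. by apply/permP => z; rewrite permM double_swapK perm1. Qed.

Lemma swap_group_set : group_set [set 1%g; double_swap]%SET.
Proof.
apply/group_setP; split; first by rewrite !inE eqxx.
move=> x y; rewrite !inE => /orP[]/eqP-> /orP[]/eqP->;
  by rewrite ?mul1g ?mulg1 ?double_swap2 eqxx ?orbT.
Qed.

Definition swap_group : {group 'S_k.+4} := Group swap_group_set.

Lemma swap_groupP s : s \in swap_group -> s = 1%g \/ s = double_swap.
Proof. by rewrite !inE => /orP[]/eqP; [left|right]. Qed.

Lemma swap_group_fix : swap_group \subset fixg proj2.
Proof.
apply/fintype.subsetP => s /swap_groupP[]->; first exact: group1.
by apply/fixgP => z; exact: proj2_double_swap.
Qed.

(** Gluing b back turns the simultaneous exchange into the exchange of the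
    two halves of a, without kernel. *)
Lemma quot_class_swap : quot_class swap_group proj2 =
  quot_class (fixg (ext a)) (ext a) * split_class cX k.+2.
Proof.
rewrite (@quot_class_base_change _ cX _ _ _ (ext (old b)) (ext a) swap_group
  (fixg_group (ext a))).
- congr (_ * _); rewrite -(quot_class_split cX (ext_onto (old b))); congr (quot_class _ _).
  apply/setP => s; rewrite finset.in_setI; apply/andP/set1P => [[/swap_groupP[->//|->]]|->].
    move=> /fixgP/(_ (old (old a))); rewrite ext_double_swap ext_old tpermL => /esym/eqP.
    by rewrite (negbTE (old_neq _)).
  by rewrite !group1.
- by [].
- exact: ext_onto.
- exact: ext_onto.
- exact: swap_group_fix.
- move=> s /swap_groupP[->|->].
    by exists 1%g; rewrite ?group1 // => i; rewrite !perm1.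
  exists (tperm (old a) ord_max); last exact: ext_double_swap.
  by apply: tperm_fixg; rewrite ext_old ext_new.
- move=> t /(fixg_split (ext_onto a) (old_neq a)).
  rewrite ext_old ext_new => /(_ erefl)[->|->].
    by exists 1%g; rewrite ?group1 // => i; rewrite !perm1.
  by exists double_swap; [rewrite !inE eqxx orbT|exact: ext_double_swap].
Qed.

Definition cuts (c : 'I_k.+2) (P Q : part k.+2) :=
  exists x y, [/\ label Q x = c, label Q y = c & label P x <> label P y].

Lemma cuts_relabel n (Z : part n) (al be : 'I_n -> 'I_k.+2) (als : onto al)
    (bes : onto be) c :
  cuts c (relabel X als Z) (relabel X bes Z) <->
  exists z z', [/\ be z = c, be z' = c & al z <> al z'].
Proof.
split=> [[x [y]]|[z [z']]].
  by rewrite !relabelE => xy; exists (label Z x), (label Z y).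
have [x <-] := label_onto Z z; have [y <-] := label_onto Z z' => xy.
by exists x, y; rewrite !relabelE.
Qed.

Lemma cuts_perm c (s : 'S_k.+2) P Q : cuts c (pperm X s P) Q <-> cuts c P Q.
Proof.
split=> -[x [y [Qx Qy Pxy]]]; exists x, y; split=> //.
  by move=> e; apply: Pxy; rewrite !relabelE e.
by rewrite !relabelE => /perm_inj.
Qed.

Lemma cuts_leg1 (Z : part k.+3) :
  ~ cuts a (relabel X flip1_onto Z) (relabel X (ext_onto b) Z) /\
  cuts b (relabel X flip1_onto Z) (relabel X (ext_onto b) Z).
Proof.
rewrite !cuts_relabel; split; last first.
  exists (old b), ord_max; rewrite ext_old ext_new flip1_old flip1_new eqxx.
  by split=> //; exact/eqP.
have only w : ext b w = a -> w = old a.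
  elim/ord_oldP: w => [y|]; rewrite ?ext_old ?ext_new; first by move->.
  by move/eqP; rewrite (negbTE ba).
by move=> [z [z' [/only -> /only ->]]].
Qed.

Lemma cuts_leg2 (Z : part k.+3) :
  cuts a (relabel X (ext_onto b) Z) (relabel X (ext_onto a) Z) /\
  ~ cuts b (relabel X (ext_onto b) Z) (relabel X (ext_onto a) Z).
Proof.
rewrite !cuts_relabel; split.
  exists (old a), ord_max; rewrite !ext_old !ext_new; split=> //; exact/eqP.
have only w : ext a w = b -> w = old b.
  elim/ord_oldP: w => [y|]; rewrite ?ext_old ?ext_new; first by move->.
  by move/eqP; rewrite (negbTE ab).
by move=> [z [z' [/only -> /only ->]]].
Qed.

Lemma cuts_leg3 (Z : part k.+4) :
  cuts a (relabel X flip2_onto Z) (relabel X proj2_onto Z) /\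
  cuts b (relabel X flip2_onto Z) (relabel X proj2_onto Z).
Proof.
rewrite !cuts_relabel; split.
  exists (old (old a)), (old ord_max).
  rewrite /proj2 !flip2_old flip1_old flip1_new !ext_old ext_new (negbTE ab).
  by split=> //; exact/eqP.
exists (old (old b)), ord_max.
rewrite /proj2 !flip2_old flip2_new flip1_old !ext_old ext_new ext_old eqxx.
by split=> //; exact/eqP.
Qed.

Definition near (u v : 'I_k.+2) := [\/ u = v, u = a /\ v = b | u = b /\ v = a].

Lemma near_fiber u v : r u = r v -> near u v.
Proof. exact: split_kernel. Qed.

Lemma near_tperm u v : near u v -> near (tperm a b u) v.
Proof.
case=> [->|[-> ->]|[-> ->]]; rewrite ?tpermL ?tpermR; last 2 first.
- by constructor 1.
- by constructor 1.
case: tpermP => [->|->|_ _]; [by constructor 3|by constructor 2|by constructor 1].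
Qed.

Lemma cuts_both c (P Q : part k.+2) : (forall x, near (label P x) (label Q x)) ->
  c = a \/ c = b -> cuts c P Q ->
  (exists x, label Q x = c /\ label P x = a) /\ (exists x, label Q x = c /\ label P x = b).
Proof.
move=> nPQ cab [x [y [Qx Qy Pxy]]].
have val z : label Q z = c -> label P z = a \/ label P z = b.
  by move=> Qz; have := nPQ z; rewrite Qz => -[->|[-> _]|[-> _]]; [|left|right].
case: (val x Qx) (val y Qy) => Px [] Py;
  try by [split; [exists x|exists y]|split; [exists y|exists x]].
- by rewrite Px Py in Pxy.
- by rewrite Px Py in Pxy.
Qed.

(** If P does not cut the part c of Q, exchanging the names a and b in P makes P
    and Q agree on that part. *)
Lemma uncut_normal c (P Q : part k.+2) : (forall x, near (label P x) (label Q x)) ->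
  c = a \/ c = b -> ~ cuts c P Q ->
  exists s : 'S_k.+2, [/\ s \in fixg r, forall x, near (label (pperm X s P) x) (label Q x) &
    forall x, label Q x = c -> label (pperm X s P) x = c].
Proof.
move=> nPQ cab ncut; have [x0 Qx0] := label_onto Q c.
have same x : label Q x = c -> label P x = label P x0.
  by move=> Qx; apply: contrapT => Pxx0; apply: ncut; exists x, x0.
have [Px0|Px0] := pselect (label P x0 = c).
  by exists 1%g; rewrite group1 pperm1; split=> // x /same ->.
exists (tperm a b); split; first exact: tperm_fixg.
  by move=> x; rewrite relabelE; exact: near_tperm.
move=> x /same; rewrite relabelE => ->; have := nPQ x0; rewrite Qx0.
by case=> [//|[-> ->]|[-> ->]]; rewrite ?tpermL ?tpermR.
Qed.

(** An unordered cut P of the part that r glues from a and b is compared with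
    the cut Q into a and b. There are four cases, distinguished by whether P cuts a
    and whether it cuts b. If it cuts neither, P is Q without order; if it cuts one
    of them, this is an ordered cut of that part, since the pieces are
    distinguished by the half of P that they join; if it cuts both, both cuts are
    ordered up to a simultaneous exchange. *)
Theorem split_relation :
  quot_class (fixg r) r = 1 + split_class cX k.+1 + split_class cX k.+1 +
    quot_class (fixg (ext a)) (ext a) * split_class cX k.+2.
Proof.
have [S [q [f [tm [[qs qG] fr ->]]]]] := quot_classP cX (ltn0Sn k) rs (subxx (fixg r)).
have [V [v [w [tV [[vs vG] wr wE]]]]] :=
  quot_classP cX (ltn0Sn k.+1) proj2_onto swap_group_fix.
pose tU := part_gtransitive cX (ltn0Sn k.+1).
have pE c : split_class cX k.+1 =
    tclass (relabel X (ext_onto c) : gmap (partF _) (partF _)) tU.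
  by rewrite -(quot_class_split cX (ext_onto c)) (quot_class1E cX (ext_onto c) (ltn0Sn k.+1)).
rewrite -quot_class_swap wE.
have [u uE] : exists u : gmap V S, forall Z, u (v Z) = q (relabel X flip2_onto Z).
  apply: (gmap_factor (r := gcomp q (relabel X flip2_onto))) => // Z Z' /vG[s sD ->].
  apply/qG; case: (swap_groupP sD) => ->; first by exists 1%g; rewrite ?group1 // !pperm1.
  exists (tperm a b); first exact: tperm_fixg.
  by apply: partP => x; rewrite !relabelE flip2_double_swap.
have wvE Z : w (v Z) = relabel X proj2_onto Z by apply: partP => x; rewrite wr relabelE.
(* The bits of i say whether a and b are cut. *)
pose L i : leg S (partF k.+2) := match i with
  | 0 => @Leg X S (partF k.+2) (partF k.+2) q (gid _)
  | 1 => @Leg X S (partF k.+2) (partF k.+3) (gcomp q (relabel X flip1_onto))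
           (relabel X (ext_onto b))
  | 2 => @Leg X S (partF k.+2) (partF k.+3) (gcomp q (relabel X (ext_onto b)))
           (relabel X (ext_onto a))
  | _ => @Leg X S (partF k.+2) V u w end.
have LP i z : (i < 4)%N -> exists P, [/\ leg1 (L i) z = q P,
    cuts a P (leg2 (L i) z) <-> (1 < i)%N & cuts b P (leg2 (L i) z) <-> odd i].
  case: i z => [|[|[|[|//]]]] z _ /=.
  - by exists z; split=> //; split=> // -[x [y [<- e]]]; rewrite e.
  - exists (relabel X flip1_onto z); have [c1 c2] := cuts_leg1 z.
    by split=> //; split.
  - exists (relabel X (ext_onto b) z); have [c1 c2] := cuts_leg2 z.
    by split=> //; split.
  - have [Z <-] := vs z; exists (relabel X flip2_onto Z).
    by rewrite uE wvE; have [c1 c2] := cuts_leg3 Z; split=> //; split.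
rewrite (@tclass_legs X S _ _ f (relabel X rs : gmap (partF _) (partF _)) tm tU 4 L).
- rewrite !big_ord_recr big_ord0 /= add0r (Prop_irrelevance tV tU).
  congr (_ + _ + _ + _); [|exact/esym/pE|exact/esym/pE].
  by apply: tclass_iso; exists (gid _); split.
- move=> i z; suff [P [Q [-> -> rPQ]]] : exists P Q : part k.+2,
      [/\ leg1 (L i) z = q P, leg2 (L i) z = Q & forall x, r (label P x) = r (label Q x)].
    by apply: partP => x; rewrite fr relabelE.
  case: i z => [|[|[|i]]] z.
  + by exists z, z.
  + exists (relabel X flip1_onto z), (relabel X (ext_onto b) z); split=> // x.
    rewrite !relabelE; elim/ord_oldP: (label z x) => [y|].
      by rewrite flip1_old ext_old; case: eqP => // ->.
    by rewrite flip1_new ext_new.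
  + exists (relabel X (ext_onto b) z), (relabel X (ext_onto a) z); split=> // x.
    by rewrite !relabelE; elim/ord_oldP: (label z x) => [y|]; rewrite ?ext_old // !ext_new.
  + have [Z <-] := vs z; exists (relabel X flip2_onto Z), (relabel X proj2_onto Z).
    split; [exact: uE|exact: wvE|move=> x]; rewrite !relabelE /proj2.
    elim/ord_oldP: (label Z x) => [y|]; last by rewrite flip2_new ext_new ext_old.
    rewrite flip2_old ext_old; elim/ord_oldP: y => [y|]; last by rewrite flip1_new ext_new.
    by rewrite flip1_old ext_old; case: eqP => // ->.
- move=> i z z'; case: i z z' => [|[|[|[|//]]]] z z' _.
  + by [].
  + move=> /qG[s /(fixg_split rs ab rab)[->|->]] e e2.
      move: e; rewrite pperm1 => e; apply: partP => x; apply: flip1_inj.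
        by rewrite -!(relabelE flip1_onto) e.
      by rewrite -!(relabelE (ext_onto b)) e2.
    have [x zx] := label_onto z (old a).
    have ez : ext b (label z' x) = a by rewrite -(relabelE (ext_onto b)) -e2 relabelE zx ext_old.
    have : flip1 (label z' x) = b.
      by rewrite -(relabelE flip1_onto) e !relabelE zx flip1_old (negbTE ab) tpermL.
    have abP : a <> b by exact/eqP.
    by elim/ord_oldP: (label z' x) ez => [y|]; rewrite ?ext_old ?ext_new ?flip1_old => e1;
      rewrite ?e1 ?(negbTE ab) => e3; congruence.
  + move=> /qG[s /(fixg_split rs ab rab)[->|->]] e e2.
      move: e; rewrite pperm1 => e; apply: partP => x.
      have := relabelE (ext_onto b) z' x; rewrite e relabelE.
      have := relabelE (ext_onto a) z' x; rewrite -e2 relabelE.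
      have abP : a <> b by exact/eqP.
      by elim/ord_oldP: (label z x) => [y|]; elim/ord_oldP: (label z' x) => [y'|];
        rewrite ?ext_old ?ext_new // => e1 e3; congruence.
    have [x zx] := label_onto z (old b).
    have ez : ext a (label z' x) = b by rewrite -(relabelE (ext_onto a)) -e2 relabelE zx ext_old.
    have : ext b (label z' x) = a.
      by rewrite -(relabelE (ext_onto b)) e !relabelE zx ext_old tpermR.
    have abP : a <> b by exact/eqP.
    by elim/ord_oldP: (label z' x) ez => [y|]; rewrite ?ext_old ?ext_new => e1 e3; congruence.
  + have [Z <-] := vs z; have [Z' <-] := vs z'.
    move=> e; have : q (relabel X flip2_onto Z) = q (relabel X flip2_onto Z') by rewrite -!uE.
    move=> /qG[s sr {}e] e2.
    have {}e2 : relabel X proj2_onto Z = relabel X proj2_onto Z' by rewrite -!wvE.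
    apply/vG; exists (if s == 1%g then 1%g else double_swap).
      by case: eqP => _; rewrite !inE eqxx ?orbT.
    apply: partP => x; apply: flip2_inj; last first.
      rewrite -(relabelE proj2_onto) -e2 !relabelE.
      by case: eqP => _; rewrite ?perm1 ?proj2_double_swap.
    rewrite -(relabelE flip2_onto) e !relabelE.
    case: eqP => [->|s1]; first by rewrite !perm1.
    by case: (fixg_split rs ab rab sr) => // ->; rewrite flip2_double_swap.
- move=> i j z w' il jl e1 e2; have [P [Pq Pa Pb]] := LP i z il.
  have [Q [Qq Qa Qb]] := LP j w' jl.
  have /qG[s _ QE] : q P = q Q by rewrite -Pq -Qq.
  have ca : (1 < i)%N = (1 < j)%N.
    by apply/idP/idP => [/Pa|/Qa]; [rewrite e2 => c; apply/Qa; rewrite QE cuts_perm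
      |rewrite -e2 QE cuts_perm => /Pa].
  have cb : odd i = odd j.
    by apply/idP/idP => [/Pb|/Qb]; [rewrite e2 => c; apply/Qb; rewrite QE cuts_perm
      |rewrite -e2 QE cuts_perm => /Pb].
  by move: i j il jl ca cb {z w' e1 e2 Pq Pa Pb Qq Qa Qb} => [|[|[|[|]]]] // [|[|[|[|]]]].
- move=> t Q; have [P0 <-] := qs t => fPQ.
  have nP0 x : near (label P0 x) (label Q x) by apply: near_fiber; rewrite -fr fPQ relabelE.
  have build n (ph : 'I_k.+2 * 'I_k.+2 -> 'I_n) (P : part k.+2) :
      (forall z, exists x, ph (label P x, label Q x) = z) ->
      exists Z : part n, forall x, label Z x = ph (label P x, label Q x).
    by move=> phs; apply: part_exists phs; apply: (clopen_fibers_comp ph);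
      exact: clopen_fibers_pair (label_clopen _) (label_clopen _).
  have [ca|nca] := pselect (cuts a P0 Q); have [cb|ncb] := pselect (cuts b P0 Q).
  + have [[xaa [Qaa Paa]] [xab [Qab Pab]]] := cuts_both nP0 (or_introl erefl) ca.
    have [[xba [Qba Pba]] [xbb [Qbb Pbb]]] := cuts_both nP0 (or_intror erefl) cb.
    pose ph (uv : 'I_k.+2 * 'I_k.+2) := if uv.1 == b then
      (if uv.2 == a then old ord_max else if uv.2 == b then ord_max else old (old uv.2))
      else old (old uv.2).
    have [|Z ZE] := build _ ph P0.
      elim/ord_oldP=> [w'|]; last by exists xbb; rewrite /ph /= Pbb Qbb eqxx (negbTE ba).
      elim/ord_oldP: w' => [y|]; last by exists xab; rewrite /ph /= Pab Qab !eqxx.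
      have [->|ya] := eqVneq y a; first by exists xaa; rewrite /ph /= Paa Qaa (negbTE ab).
      have [->|yb] := eqVneq y b; first by exists xba; rewrite /ph /= Pba Qba (negbTE ab).
      have [x Qx] := label_onto Q y; exists x; rewrite /ph /= Qx (negbTE ya) (negbTE yb).
      by case: ifP.
    have ZP x : flip2 (label Z x) = label P0 x /\ proj2 (label Z x) = label Q x.
      rewrite ZE /ph /proj2; case: (nP0 x) => [->|[-> ->]|[-> ->]] /=.
      * have [->|yb] := eqVneq (label Q x) b.
          by rewrite (negbTE ba) flip2_new ext_new ext_old.
        by rewrite flip2_old flip1_old (negbTE yb) !ext_old.
      * by rewrite (negbTE ab) flip2_old flip1_old eqxx !ext_old.
      * by rewrite !eqxx flip2_old flip1_new ext_old ext_new.
    exists 3, (v Z); split=> //=; rewrite ?uE ?wvE.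
      by congr (q _); apply: partP => x; rewrite relabelE; case: (ZP x).
    by apply: partP => x; rewrite relabelE; case: (ZP x).
  + have [s [sr nP PQ]] := uncut_normal nP0 (or_intror erefl) ncb.
    have {}ca : cuts a (pperm X s P0) Q by apply/cuts_perm.
    have -> : q P0 = q (pperm X s P0) by apply/qG; exists s.
    move: (pperm X s P0) nP PQ ca => P nP PQ ca.
    have [[xaa [Qaa Paa]] [xab [Qab Pab]]] := cuts_both nP (or_introl erefl) ca.
    pose ph (uv : 'I_k.+2 * 'I_k.+2) :=
      if (uv.1 == b) && (uv.2 == a) then ord_max else old uv.2.
    have [|Z ZE] := build _ ph P.
      elim/ord_oldP=> [y|]; last by exists xab; rewrite /ph /= Pab Qab !eqxx.
      have [->|ya] := eqVneq y a; first by exists xaa; rewrite /ph /= Paa Qaa (negbTE ab).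
      by have [x Qx] := label_onto Q y; exists x; rewrite /ph /= Qx (negbTE ya) andbF.
    have ZP x : ext b (label Z x) = label P x /\ ext a (label Z x) = label Q x.
      rewrite ZE /ph; case: (nP x) => [e|[e1 e2]|[-> ->]] /=.
      * rewrite e; have [->|yb] := eqVneq (label Q x) b; last by rewrite !ext_old.
        by rewrite (negbTE ba) !ext_old.
      * by move/eqP: ab; case; rewrite -e1 PQ.
      * by rewrite !eqxx !ext_new.
    exists 2, Z; split=> //=.
      by congr (q _); apply: partP => x; rewrite relabelE; case: (ZP x).
    by apply: partP => x; rewrite relabelE; case: (ZP x).
  + have [s [sr nP PQ]] := uncut_normal nP0 (or_introl erefl) nca.
    have {}cb : cuts b (pperm X s P0) Q by apply/cuts_perm.
    have -> : q P0 = q (pperm X s P0) by apply/qG; exists s.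
    move: (pperm X s P0) nP PQ cb => P nP PQ cb.
    have [[xba [Qba Pba]] [xbb [Qbb Pbb]]] := cuts_both nP (or_intror erefl) cb.
    pose ph (uv : 'I_k.+2 * 'I_k.+2) :=
      if (uv.1 == b) && (uv.2 == b) then ord_max else old uv.2.
    have [|Z ZE] := build _ ph P.
      elim/ord_oldP=> [y|]; last by exists xbb; rewrite /ph /= Pbb Qbb !eqxx.
      have [->|yb] := eqVneq y b; first by exists xba; rewrite /ph /= Pba Qba (negbTE ab).
      by have [x Qx] := label_onto Q y; exists x; rewrite /ph /= Qx (negbTE yb) andbF.
    have ZP x : flip1 (label Z x) = label P x /\ ext b (label Z x) = label Q x.
      rewrite ZE /ph; case: (nP x) => [e|[-> ->]|[e1 e2]] /=.
      * rewrite e; have [->|yb] := eqVneq (label Q x) b; first by rewrite flip1_new ext_new.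
        by rewrite flip1_old (negbTE yb) ext_old.
      * by rewrite (negbTE ab) flip1_old eqxx ext_old.
      * by move/eqP: ba; case; rewrite -e1 PQ.
    exists 1, Z; split=> //=.
      by congr (q _); apply: partP => x; rewrite relabelE; case: (ZP x).
    by apply: partP => x; rewrite relabelE; case: (ZP x).
  + have [s [sr nP PQ]] := uncut_normal nP0 (or_introl erefl) nca.
    have {}ncb : ~ cuts b (pperm X s P0) Q by rewrite cuts_perm.
    have -> : q P0 = q (pperm X s P0) by apply/qG; exists s.
    move: (pperm X s P0) nP PQ ncb => P nP PQ ncb.
    have [x1 Px1] := label_onto P b.
    have Qx1 : label Q x1 = b.
      case: (nP x1) => [<- //|[_ ->] //|[_ /PQ]].
      by rewrite Px1 => /eqP; rewrite (negbTE ba).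
    exists 0, Q; split=> //=; congr (q _); apply: partP => x.
    case: (nP x) => [//|[e1 e2]|[e1 e2]]; last by rewrite (PQ x e2) e2.
    apply: contrapT => _; apply: ncb; exists x, x1; split=> //.
    by rewrite e1 Px1; exact/eqP.
Qed.

End SplitRelation.

(** * Fractions with respect to an idempotent *)

Section Rational.
Variable R : comPzRingType.
Implicit Types (u x y : R) (A : pred nat).

(** On the component of u, x is a quotient of an integer by an element of A. *)
Definition fraction u A x := exists a (c : int), A a /\ u * (a%:R * x) = u * c%:~R.

Lemma fraction_int u A (c : int) : A 1%N -> fraction u A c%:~R.
Proof. by move=> A1; exists 1%N, c; rewrite mul1r. Qed.

Section Closed.
Variables (u : R) (A : pred nat).
Hypothesis AM : forall a b, A a -> A b -> A (a * b)%N.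

Lemma fractionD x y : fraction u A x -> fraction u A y -> fraction u A (x + y).
Proof.
move=> [a [c [Aa ac]]] [b [d [Ab bd]]].
exists (a * b)%N, (b%:Z * c + a%:Z * d); split; first exact: AM.
transitivity (b%:R * (u * (a%:R * x)) + a%:R * (u * (b%:R * y))).
  by rewrite natrM; ring.
by rewrite ac bd rmorphD !rmorphM /= -!pmulrn; ring.
Qed.

Lemma fractionM x y : fraction u A x -> fraction u A y -> fraction u A (x * y).
Proof.
move=> [a [c [Aa ac]]] [b [d [Ab bd]]].
exists (a * b)%N, (c * d); split; first exact: AM.
transitivity (u * (a%:R * x) * (b%:R * y)); first by rewrite natrM; ring.
rewrite ac; transitivity (u * (b%:R * y) * c%:~R); first by ring.
by rewrite bd rmorphM /=; ring.
Qed.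

Lemma fraction_div n x : A n -> fraction u A (n%:R * x) -> fraction u A x.
Proof.
move=> An [a [c [Aa ac]]]; exists (a * n)%N, c; split; first exact: AM.
by rewrite natrM -mulrA.
Qed.
End Closed.
End Rational.

(** * Permutation groups and maps of finite sets of labels *)

Section Group.
(** Take z in the center of a Sylow subgroup for the prime 2, which is then
    contained in the centralizer of z. *)
Lemma central_involution (T : finType) (G : {group {perm T}}) :
  (2 %| #|G|)%N ->
  exists z, [/\ z \in G, z != 1%g, (z * z = 1)%g & odd (#|G : 'C_G[z]|)%g].
Proof.
move=> G2; have [P sylP] := Sylow_exists 2 G.
have [PG pP ixP] := and3P sylP.
have P1 : P :!=: 1%g.
  apply/negP => /eqP P1; move: ixP; rewrite P1 indexg1 /= => /pnatP.
  by move=> /(_ (cardG_gt0 G) 2%N isT G2).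
(* P is a nontrivial group of prime power order. *)
have Z1 : ('Z(P) != 1)%g by rewrite center_nil_eq1 // (pgroup_nil pP).
have Z2 : (2 %| #|'Z(P)%g|)%N.
  by have [_ ? _] := pgroup_pdiv (pgroupS (center_sub P) pP) Z1.
have [z zZ z2] := Cauchy (isT : prime 2) Z2.
have /centerP[zP Pz] := zZ.
exists z; split.
- exact: (fintype.subsetP PG).
- by rewrite -order_eq1 z2.
- by rewrite -[(z * z)%g]/(z ^+ 2)%g -z2 expg_order.
- have PC : (P \subset 'C_G[z])%g.
    rewrite finset.subsetI PG /=; apply/fintype.subsetP => y /Pz zy; apply/cent1P.
    exact: commute_sym.
  have : odd (#|G : P|)%g by rewrite odd_2'nat.
  by rewrite -(Lagrange_index (subsetIl G _) PC) oddM => /andP[].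
Qed.
End Group.

Lemma onto_lt n c (r : 'I_n -> 'I_c) a b : onto r -> a != b -> r a = r b -> (c < n)%N.
Proof.
move=> rs ab rab; have [h hK] := choice rs.
have cn : (c <= n)%N by have := leq_card h (can_inj hK); rewrite !card_ord.
rewrite ltn_neqAle cn andbT; apply/eqP => cE; subst c.
by move/eqP: ab; apply; exact: onto_inj rs _ _ rab.
Qed.

Lemma kernel_map n (T : finType) (f : 'I_n -> T) :
  exists c (r : 'I_n -> 'I_c), onto r /\ forall x y, r x = r y <-> f x = f y.
Proof.
pose B := [set f x | x : 'I_n]%SET; have fB x : f x \in B by exact: imset_f.
exists #|B|, (fun x => enum_rank_in (fB x) (f x)); split=> [j|x y].
  have /imsetP[x _ fx] := enum_valP j; exists x; apply: enum_val_inj.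
  by rewrite enum_rankK_in.
split=> [/(congr1 enum_val)|fxy]; first by rewrite !enum_rankK_in.
by apply: enum_val_inj; rewrite !enum_rankK_in.
Qed.

Lemma merge_pair k (a b : 'I_k.+2) : a != b ->
  exists2 r : 'I_k.+2 -> 'I_k.+1, onto r & r a = r b.
Proof.
move=> ab; have [s [sb sa]] := perm_pair (old_neq (ord0 : 'I_k.+1)) ab.
exists (ext ord0 \o s); last by rewrite /= sb sa ext_old ext_new.
by apply: onto_comp (ext_onto _) => j; exists ((s^-1)%g j); rewrite permKV.
Qed.

Section Descend.
Variables (n m : nat) (r : 'I_n -> 'I_m) (G : {group 'S_n}).

Definition descent : {set 'S_m} :=
  [set t : 'S_m | [exists s in G, [forall i, r (s i) == t (r i)]]]%SET.

Lemma descentP (t : 'S_m) :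
  reflect (exists2 s, s \in G & forall i, r (s i) = t (r i)) (t \in descent).
Proof.
rewrite inE; apply: (iffP exists_inP) => [[s sG /forallP st]|[s sG st]].
  by exists s => // i; exact/eqP.
by exists s => //; apply/forallP => i; exact/eqP.
Qed.

Lemma descent_group_set : group_set descent.
Proof.
apply/group_setP; split; first by apply/descentP; exists 1%g => // i; rewrite !perm1.
move=> t t' /descentP[s sG st] /descentP[s' s'G s't']; apply/descentP.
by exists (s * s')%g; [exact: groupM|move=> i; rewrite !permM s't' st].
Qed.

Canonical descent_group := Group descent_group_set.

Lemma descent_ex (s : 'S_n) : onto r -> s \in G ->
  (forall x y, r x = r y -> r (s x) = r (s y)) ->
  exists2 t, t \in descent & forall i, r (s i) = t (r i).
Proof.
move=> rs sG /(onto_factor (g := r \o s) rs)[h hE].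
have hs : onto h.
  by move=> j; have [i <-] := rs j; exists (r ((s^-1)%g i)); rewrite hE /= permKV.
exists (perm (onto_inj hs)); last by move=> i; rewrite permE hE.
by apply/descentP; exists s => // i; rewrite permE hE.
Qed.

End Descend.

(** * Symmetric quotients have rational classes *)

Section Ring.
Variables (X : top_space) (cX : is_cantor X).
Notation part := (surj_gset X).
Notation partF n := (surj_fgset n cX).
Notation quot_class := (quot_class cX).
Notation split_class := (split_class cX).

(** The symmetries of a single cut are the identity and one exchange. *)
Lemma split_class_double k (r : 'I_k.+2 -> 'I_k.+1) :
  onto r -> split_class k = 2 * quot_class (fixg r) r.
Proof.
move=> rs; have [a [b [ab rab]]] := split_pair r.
rewrite -(quot_class_split cX rs).
rewrite (@quot_class_index _ cX _ _ r 1%G (fixg_group r)) ?sub1G //.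
have fE : fixg r = [set 1%g; tperm a b]%SET.
  apply/setP => s; rewrite !inE; apply/idP/orP => [sr|[]/eqP->].
  - have : s \in fixg r by rewrite inE.
    by move=> /(fixg_split rs ab rab)[->|->]; [left|right].
  - by apply/'forall_eqP => i; rewrite perm1.
  - by have := tperm_fixg rab; rewrite inE.
rewrite indexg1 /= fE cards2 (_ : 1%g != tperm a b) //.
apply: contra ab => /eqP/permP/(_ a); rewrite perm1 tpermL => ->.
exact: eqxx.
Qed.

Lemma split_class_relation k (r : 'I_k.+2 -> 'I_k.+1) : onto r -> exists t,
  [/\ 2 * t = split_class k.+1,
      quot_class (fixg r) r =
        1 + split_class k.+1 + split_class k.+1 + t * split_class k.+2 &
      split_class k = 2 + 4 * split_class k.+1 + split_class k.+1 * split_class k.+2].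
Proof.
move=> rs; have [a [b [ab rab]]] := split_pair r.
have sr := split_relation cX rs ab rab; have aa := split_class_double (ext_onto a).
set t := quot_class (fixg (ext a)) (ext a) in sr aa *; exists t; split=> //.
rewrite (split_class_double rs) sr.
transitivity (2 + 4 * split_class k.+1 + 2 * t * split_class k.+2); first by ring.
by rewrite -aa.
Qed.

(** The common value p of all split_class k. *)
Definition splitting := split_class 1.

Lemma split_classE k : split_class k = splitting.
Proof.
have pk j : split_class j.+1 = splitting.
  by elim: j => // j IHj; rewrite split_class_const.
have [_ [_ _ e0]] := split_class_relation (ext_onto (ord0 : 'I_1)).
have [_ [_ _ e1]] := split_class_relation (ext_onto (ord0 : 'I_2)).
by case: k => [|k]; [rewrite e0 [RHS]e1 !pk|exact: pk].
Qed.

(** The idempotent that is 1 where p = -1 and 0 where p = -2. *)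
Definition nu_idem := splitting + 2.

Lemma splitting_eq : splitting = 2 + 4 * splitting + splitting * splitting.
Proof.
have [_ [_ _]] := split_class_relation (ext_onto (ord0 : 'I_1)).
by rewrite !split_classE.
Qed.

Lemma nu_idemM : nu_idem * nu_idem = nu_idem.
Proof.
rewrite /nu_idem; transitivity (2 + 4 * splitting + splitting * splitting + 2); first by ring.
by rewrite -splitting_eq.
Qed.

(** With t the class of an unordered cut, 2 (t + 1) = p + 2, and split_relation
    reads t + 1 = (p + 2) (t' + 1), where t' is the class of a later unordered
    cut. *)
Lemma split_sym k (r : 'I_k.+2 -> 'I_k.+1) : onto r ->
  2 * (quot_class (fixg r) r + 1) = nu_idem /\ (1 - nu_idem) * (quot_class (fixg r) r + 1) = 0.
Proof.
move=> rs; split.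
  by rewrite /nu_idem -(split_classE k) (split_class_double rs); ring.
have [t [t2 -> _]] := split_class_relation rs; rewrite !split_classE in t2 *.
transitivity ((1 - nu_idem) * (nu_idem * (t + 1)) + (1 - nu_idem) * (splitting - 2 * t)).
  by rewrite /nu_idem; ring.
rewrite t2 subrr mulr0 addr0 mulrA.
by rewrite mulrBl mul1r nu_idemM subrr mul0r.
Qed.

(** Membership in the subring that will turn out to be everything: the
    component on which mu lives has odd denominators. *)
Definition is_rational (x : Theta X) :=
  fraction (1 - nu_idem) odd x /\ fraction nu_idem (fun n => 0 < n)%N x.

Lemma oddMn a b : odd a -> odd b -> odd (a * b).
Proof. by rewrite oddM => -> ->. Qed.

Lemma posMn a b : (0 < a)%N -> (0 < b)%N -> (0 < a * b)%N.
Proof. by rewrite muln_gt0 => -> ->. Qed.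

Lemma is_rational_int (c : int) : is_rational c%:~R.
Proof. by split; apply: fraction_int. Qed.

Lemma is_rationalD x y : is_rational x -> is_rational y -> is_rational (x + y).
Proof.
move=> [x1 x2] [y1 y2]; split; first exact: (fractionD oddMn x1 y1).
exact: (fractionD posMn x2 y2).
Qed.

Lemma is_rationalM x y : is_rational x -> is_rational y -> is_rational (x * y).
Proof.
move=> [x1 x2] [y1 y2]; split; first exact: (fractionM oddMn x1 y1).
exact: (fractionM posMn x2 y2).
Qed.

Lemma is_rational_nat (n : nat) : is_rational n%:R.
Proof. exact: (is_rational_int n). Qed.

Lemma is_rational_odd n x : odd n -> is_rational (n%:R * x) -> is_rational x.
Proof.
move=> on [x1 x2]; split; first exact: (fraction_div oddMn on).
by apply: (fraction_div posMn _ x2); case: n on {x1 x2}.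
Qed.

Lemma is_rational_split k (r : 'I_k.+2 -> 'I_k.+1) :
  onto r -> is_rational (quot_class (fixg r) r).
Proof.
move=> /split_sym[w2 w0]; rewrite -[quot_class _ _](addrK 1).
apply: is_rationalD; last exact: (is_rational_int (-1)).
split; first by exists 1%N, 0; rewrite mul1r w0 mulr0.
by exists 2%N, 1; rewrite w2 nu_idemM mulr1.
Qed.

(** Both factors of the base change formula differ from classes of full
    symmetric quotients by an index. *)
Lemma is_rational_descend n m k (r : 'I_n -> 'I_m) (p : 'I_m -> 'I_k) (G : {group 'S_n}) :
  (0 < k)%N -> onto r -> onto p -> G \subset fixg (p \o r) ->
  (forall s, s \in G -> forall x y, r x = r y -> r (s x) = r (s y)) ->
  is_rational (quot_class (fixg r) r) -> is_rational (quot_class (fixg p) p) ->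
  is_rational (quot_class G (p \o r)).
Proof.
move=> k0 rs ps Gpr Gr rK pK.
rewrite (@quot_class_base_change _ cX _ _ _ r p G (descent_group r G)) //; last first.
- by move=> t /descentP.
- by move=> s sG; apply: descent_ex => //; exact: Gr.
have Hp : descent r G \subset fixg p.
  apply/fintype.subsetP => t /descentP[s /(fintype.subsetP Gpr)/fixgP sG st].
  by apply/fixgP => j; have [i <-] := rs j; rewrite -st; exact: sG.
apply: is_rationalM.
  rewrite (@quot_class_index _ cX _ _ p (descent_group r G) (fixg_group p)) //.
  by apply: is_rationalM pK; exact: is_rational_nat.
rewrite (@quot_class_index _ cX _ _ r (G :&: fixg r)%G (fixg_group r))
  ?subsetIr ?(onto_gt0 ps) //.
by apply: is_rationalM rK; exact: is_rational_nat.
Qed.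

Lemma fixg_inj n m (r : 'I_n -> 'I_m) : injective r -> fixg r = 1%g.
Proof.
move=> rinj; apply/setP => s; apply/fixgP/set1P => [sr|-> i]; last by rewrite perm1.
by apply/permP => i; rewrite perm1; exact: rinj.
Qed.

Lemma is_rational_inj n m (r : 'I_n -> 'I_m) : (0 < m)%N -> onto r -> injective r ->
  is_rational (quot_class (fixg r) r).
Proof.
by move=> m0 rs rinj; rewrite fixg_inj // quot_class_inj //; exact: (is_rational_int 1).
Qed.

Lemma not_inj_pair n m (r : 'I_n -> 'I_m) : ~ injective r -> exists a b, a != b /\ r a = r b.
Proof.
move=> ninj; apply: contrapT => nab; apply: ninj => a b rab.
by apply/eqP/negPn/negP => ab; apply: nab; exists a, b.
Qed.

Definition fibers2 n m (r : 'I_n -> 'I_m) :=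
  forall x y z, r x = r y -> r y = r z -> [\/ x = y, y = z | x = z].

(** When p only glues pairs of labels, the pairs can be glued one at a time,
    and each step has the class of an unordered cut. *)
Lemma is_rational_fibers2 n m (p : 'I_n -> 'I_m) :
  (0 < m)%N -> onto p -> fibers2 p -> is_rational (quot_class (fixg p) p).
Proof.
move=> m0; elim: n p => [|n IHn] p ps p2; first by have := onto_gt0 ps m0.
have [pinj|/not_inj_pair[a [b [ab pab]]]] := pselect (injective p).
  exact: is_rational_inj.
case: n => [|n] in p ps p2 a b ab pab IHn *; first by rewrite !ord1 eqxx in ab.
have [r rs rab] := merge_pair ab; have ker := split_kernel rs ab rab.
have [|h hE] := onto_factor (g := p) rs.
  by move=> x y /ker[->|[-> ->]|[-> ->]].
have hs : onto h by move=> j; have [i <-] := ps j; exists (r i); rewrite hE.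
have -> : p = h \o r by apply/funext => i; rewrite /= hE.
have -> : fixg (h \o r) = fixg p by congr fixg; apply/funext => i; rewrite /= hE.
rewrite -[fixg p]/(fixg_group p : {set _}).
apply: is_rational_descend => //.
- rewrite (_ : h \o r = p) ?(subxx (fixg p)) //.
  by apply/funext => i; rewrite /= hE.
- move=> s /fixgP sp.
  have sab c : c = a \/ c = b -> r (s c) = r a.
    move=> cab; have pc : p c = p a by case: cab => ->.
    have [e|e|e] := p2 a b (s c) pab (etrans (esym pab) (etrans (esym pc) (esym (sp c)))).
    - by move/eqP: ab.
    - by rewrite -e rab.
    - by rewrite -e.
  move=> x y /ker[->//|[-> ->]|[-> ->]]; rewrite (sab a) ?(sab b) //; tauto.
- exact: is_rational_split.
- apply: IHn => // x y z; have [x' <-] := rs x; have [y' <-] := rs y; have [z' <-] := rs z.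
  by rewrite !hE => xy yz; have [->|->|->] := p2 _ _ _ xy yz;
   [constructor 1|constructor 2|constructor 3].
Qed.

(** Induction on the number of labels. The index of the centralizer of a suitable
    involution z is odd, so it may replace the whole group; it permutes
    the orbits of z, which have at most two elements and are fewer than the
    labels. *)
Theorem is_rational_fixg n m (p : 'I_n -> 'I_m) :
  (0 < m)%N -> onto p -> is_rational (quot_class (fixg p) p).
Proof.
move=> m0; elim/ltn_ind: n p => n IHn p ps.
have [pinj|/not_inj_pair[a [b [ab pab]]]] := pselect (injective p).
  exact: is_rational_inj.
have even : (2 %| #|fixg_group p|)%N.
  have <- : #[tperm a b]%g = 2%N.
    apply: nt_prime_order => //.
      by apply/permP => i; rewrite expgS expg1 permM tpermK perm1.
    by apply: contra ab => /eqP/permP/(_ a); rewrite perm1 tpermL => ->.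
  by apply: order_dvdG; exact: tperm_fixg.
have [z [zG z1 zz oC]] := central_involution even.
have zK i : z (z i) = i by rewrite -permM zz perm1.
have [c [r [rs rE]]] := kernel_map (fun i => [set i; z i]%SET).
have rP x y : r x = r y <-> x = y \/ y = z x.
  rewrite rE; split=> [e|[->|->] //].
    have : y \in [set x; z x]%SET by rewrite e !inE eqxx.
    by rewrite !inE => /orP[/eqP ->|/eqP ->]; [left|right].
  by rewrite zK finset.setUC.
(* z preserves the fibers of p, so p factors through the orbits of z. *)
have [|h hE] := onto_factor (g := p) rs.
  by move=> x y /rP[->//|->]; move/fixgP: zG => ->.
have hs : onto h by move=> j; have [i <-] := ps j; exists (r i); rewrite hE.
have phr : p = h \o r by apply/funext => i; rewrite /= hE.
apply: (is_rational_odd oC).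
rewrite -(@quot_class_index _ cX _ _ p 'C_(fixg p)[z]%G (fixg_group p)) //;
  last by exact: subsetIl.
rewrite [X in is_rational (quot_class _ X)]phr; apply: is_rational_descend => //.
- by rewrite -phr; exact: subsetIl.
- move=> s /setIP[_ /cent1P sz] x y /rP[->//|->]; apply/rP; right.
  by rewrite -permM -sz permM.
- apply: is_rational_fibers2 => //; first exact: onto_gt0 hs m0.
  move=> x y w /rP[->|->]; first by constructor 1.
  by move=> /rP[->|->]; [constructor 2|constructor 3; rewrite zK].
- apply: IHn => //; have [x zx] : exists x, z x != x.
    apply: contrapT => nz; case/eqP: z1; apply/permP => x; rewrite perm1.
    by apply/eqP/negPn/negP => zx; apply: nz; exists x.
  by apply: (onto_lt rs zx); apply/rP; right; rewrite zK.
Qed.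

End Ring.

(** * Every class is rational *)

Section Classification.
Variables (X : top_space) (cX : is_cantor X).
Notation part := (surj_gset X).
Notation partF n := (surj_fgset n cX).
Notation quot_class := (quot_class cX).

Lemma space_inhabited : exists x : X, True.
Proof.
have [P _] := part_inhabited cX (ltn0Sn 0).
by have [x _] := label_onto P ord0; exists x.
Qed.

Lemma labeling_part (I : finType) (Z : X -> I) : clopen_fibers Z ->
  exists n (P : part n), (0 < n)%N /\ forall x y, label P x = label P y <-> Z x = Z y.
Proof.
move=> Zc; pose B := [set i | `[< range Z i >]]%SET.
have ZB x : Z x \in B by rewrite inE; apply/asboolP; exists x.
have [x0 _] := space_inhabited; pose rk i := enum_rank_in (ZB x0) i.
have [|P PE] := part_exists (clopen_fibers_comp rk Zc).
  move=> j; have : enum_val j \in B by exact: enum_valP.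
  rewrite inE => /asboolP[x _ Zx]; exists x; apply: enum_val_inj.
  by rewrite /= /rk Zx enum_rankK_in // enum_valP.
exists #|B|, P; split; first by apply/card_gt0P; exists (Z x0).
move=> x y; rewrite !PE /= /rk; split=> [/(congr1 enum_val)|->//].
by rewrite !enum_rankK_in.
Qed.

(** An open subgroup contains the common stabilizer of finitely many clopen
    sets, and hence that of the partition that they generate. *)
Lemma part_dominates (S : gset X) (s : S) :
  exists n (P : part n), (0 < n)%N /\ forall g, gact g P = P -> gact g s = s.
Proof.
have : nbhs (1%g : Homeo X) [set h | gact h s = s].
  by apply: open_nbhs_nbhs; split; [exact: gact_smooth|exact: gact1].
move=> [_ [l lc ->] lsub].
have [I [Z [Zc Zl]]] : exists (I : finType) (Z : X -> I), clopen_fibers Z /\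
    forall A, A \in l -> forall x y, Z x = Z y -> A x -> A y.
  elim: l lc {lsub} => [|A l IHl] lc; first by exists unit, (fun=> tt); split=> // i;
    rewrite (_ : _ @^-1` _ = setT); [exact: clopenT|apply/seteqP; split=> // x _; case: i].
  have [|I [Z [Zc Zl]]] := IHl; first by move=> B Bl; apply: lc; rewrite inE Bl orbT.
  have Ac : clopen_fibers (fun x => `[< A x >]).
    have Acl : clopen A by apply: lc; rewrite mem_head.
    case.
      rewrite (_ : _ @^-1` _ = A) //.
      by apply/seteqP; split=> x /=; [move/asboolP|move=> Ax; apply/asboolP].
    rewrite (_ : _ @^-1` _ = ~` A); first exact: (clopenC set0).
    by apply/seteqP; split=> x /=; [move/asboolPn|move=> Ax; apply/asboolPn].
  exists _, (fun x => (Z x, `[< A x >])); split; first exact: clopen_fibers_pair.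
  move=> B; rewrite inE => /orP[/eqP->|Bl] x y [Zxy Axy]; last exact: Zl.
  by move=> Ax; apply/asboolP; rewrite -Axy; apply/asboolP.
have [n [P [n0 PZ]]] := labeling_part Zc; exists n, P; split=> // g gP.
suff : [set h | gact h s = s] g by [].
apply: lsub; exists g; last by rewrite mul1g.
move=> A /= Al; rewrite /setwise_stab /=.
have gA x : Z (hinv g x) = Z x by apply/PZ; rewrite -label_act gP.
apply/seteqP; split=> [_ [x Ax <-]|x Ax].
  by apply: (Zl A Al x) => //; rewrite -(gA (hmap g x)) hmapK.
by exists (hinv g x); [apply: (Zl A Al x)|exact: hinvK].
Qed.

Lemma part_cover (T : gset X) : gtransitive T ->
  exists n (h : gmap (part n) T), (0 < n)%N /\ forall t, exists P, h P = t.
Proof.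
move=> tT; have [t0 _] := tT; have [n [P0 [n0 Pt]]] := part_dominates t0.
have /choice[h hP] : forall Q : part n, exists t, exists g, gact g P0 = Q /\ gact g t0 = t.
  by move=> Q; have [g gP] := part_transitive cX P0 Q; exists (gact g t0), g.
have hE g : h (gact g P0) = gact g t0.
  have [g' [gP <-]] := hP (gact g P0).
  have : gact (g^-1 * g')%g t0 = t0 by apply: Pt; rewrite gactM gP gactK.
  by rewrite gactM => /(congr1 (gact g)); rewrite gactVK.
have hM g Q : h (gact g Q) = gact g (h Q).
  have [g0 <-] := part_transitive cX P0 Q.
  by rewrite -gactM !hE gactM.
exists n, (GMap hM); split=> // t.
have [g <-] := gtransitiveP tT t0 t; exists (gact g P0); exact: hE.
Qed.

Definition pattern n m (P : part n) (Q : part m) : set ('I_n * 'I_m) :=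
  range (fun x => (label P x, label Q x)).

Lemma pattern_transitive n m (P P' : part n) (Q Q' : part m) :
  pattern P Q = pattern P' Q' -> exists g, gact g P = P' /\ gact g Q = Q'.
Proof.
move=> PQ; have [g gE] := homogeneous cX (clopen_fibers_pair (label_clopen P) (label_clopen Q))
  (clopen_fibers_pair (label_clopen P') (label_clopen Q')) PQ.
have gx x : (label P' x, label Q' x) = (label P (hinv g x), label Q (hinv g x)).
  by rewrite -gE [hmap g _]hinvK.
exists g; split; apply: partP => x; rewrite label_act; apply/esym.
  exact: (congr1 fst (gx x)).
exact: (congr1 snd (gx x)).
Qed.

(** The orbit of (q P, Q) is determined by the pattern of (P, Q), and there are
    finitely many patterns. *)
Lemma fiber_finitary m n (S T : gset X) (q : gmap (part m) S) (f : gmap S T)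
    (h : gmap (part n) T) :
  (forall s, exists P, q P = s) -> finitary (fib_gset f h).
Proof.
move=> qs; apply: (@finitary_classified _ _ {set 'I_m * 'I_n}%type
  (fun z M => exists P, q P = fib1 f h z /\ forall uv, uv \in M <-> pattern P (fib2 f h z) uv)).
  move=> z; have [P Pz] := qs (fib1 f h z).
  exists [set uv | `[< pattern P (fib2 f h z) uv >]]%SET, P; split=> // uv.
  by rewrite inE; split=> /asboolP.
move=> M z w [P [Pz PM]] [Q [Qw QM]].
have [|g [gP gz]] := @pattern_transitive _ _ P Q (fib2 f h z) (fib2 f h w).
  by apply/seteqP; split=> uv; [move/PM/QM|move/QM/PM].
by exists g; apply: fib_carP; [rewrite -[LHS]/(gact g (fib1 f h z)) -Pz -gfunM gP|].
Qed.

(** u P is fixed by the stabilizer of P. If u P cut a part of P, exchanging the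
    labels of two of the pieces inside that part would not change the pattern,
    so some element of the stabilizer would move u P. *)
Lemma gmap_parts n m (u : gmap (part n) (part m)) : (0 < n)%N ->
  exists p : 'I_n -> 'I_m, onto p /\ forall P x, label (u P) x = p (label P x).
Proof.
move=> n0; have [P0 _] := part_inhabited cX n0.
have fact x y : label P0 x = label P0 y -> label (u P0) x = label (u P0) y.
  move=> xy; apply: contrapT => kk.
  set i := label P0 x in xy; set k := label (u P0) x in kk; set k' := label (u P0) y in kk.
  (* The exchange of k and k' inside the part i only. *)
  pose ph (w : 'I_n * 'I_m) := if w.1 == i then tperm k k' w.2 else w.2.
  have phc := clopen_fibers_comp ph
    (clopen_fibers_pair (label_clopen P0) (label_clopen (u P0))).
  have [|R RE] := part_exists phc.
    move=> t; have [z zt] := label_onto (u P0) t.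
    have [->|tk] := eqVneq t k.
      by exists y; rewrite /ph /= -xy eqxx -/k' tpermR.
    have [->|tk'] := eqVneq t k'.
      by exists x; rewrite /ph /= eqxx -/k tpermL.
    by exists z; rewrite /ph /= zt; case: ifP => // _; rewrite tpermD // eq_sym.
  have [|g [gP gR]] := @pattern_transitive _ _ P0 P0 (u P0) R.
    apply/seteqP; split=> _ [z _ <-].
      have [zi|zi] := eqVneq (label P0 z) i; last first.
        by exists z => //; rewrite RE /ph /= (negbTE zi).
      have [zk|zk] := eqVneq (label (u P0) z) k.
        by exists y => //; rewrite RE /ph /= -xy eqxx -/k' tpermR zi zk.
      have [zk'|zk'] := eqVneq (label (u P0) z) k'.
        by exists x => //; rewrite RE /ph /= eqxx -/k tpermL zi zk'.
      by exists z => //; rewrite RE /ph /= zi eqxx tpermD // eq_sym.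
    rewrite RE /ph /=; case: eqP => [zi|_]; last by exists z.
    rewrite zi; case: tpermP => [_|_|_ _]; last by exists z; rewrite // zi.
      by exists y => //; rewrite -xy.
    by exists x.
  have : R = u P0 by rewrite -gR -gfunM gP.
  move=> /(congr1 (fun Q => label Q x)); rewrite RE /ph /= eqxx -/k tpermL => k'k.
  exact: kk.
have [p pE] := onto_factor (label_onto P0) fact.
exists p; split; first by move=> j; have [x <-] := label_onto (u P0) j; exists (label P0 x).
move=> P x; have [g <-] := part_transitive cX P0 P.
by rewrite gfunM !label_act pE.
Qed.

Lemma same_pattern n (S : gset X) (q : gmap (part n) S) (P Q P' Q' : part n) :
  pattern P Q = pattern P' Q' -> q P = q Q -> q P' = q Q'.
Proof. by move=> /pattern_transitive[g [<- <-]] PQ; rewrite !gfunM PQ. Qed.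

(** The relation q P = q Q depends only on the pattern of (P, Q) and is
    transitive. Any set W of triples of labels is realized by three labelings, so
    the patterns may be composed along any W with the given projections, not only
    along the largest one. *)
Lemma compose_patterns n (S : gset X) (q : gmap (part n) S)
    (W : set ('I_n * 'I_n * 'I_n)) :
  (forall P Q, pattern P Q = [set (w.1.1, w.1.2) | w in W] -> q P = q Q) ->
  (forall P Q, pattern P Q = [set (w.1.2, w.2) | w in W] -> q P = q Q) ->
  (forall i, exists j l, W (i, j, l)) -> (forall j, exists i l, W (i, j, l)) ->
  (forall l, exists i j, W (i, j, l)) ->
  forall P R, pattern P R = [set (w.1.1, w.2) | w in W] -> q P = q R.
Proof.
move=> W12 W23 Wi Wj Wl P R PR.
have [|Z Zc ZW] := @exists_labeling X cX _ W.
  have [x _] := space_inhabited; have [j [l Wx]] := Wi (label P x).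
  by exists (label P x, j, l).
have ex w : W w -> exists x, Z x = w by rewrite -ZW => -[x _ <-]; exists x.
have [|P0 P0E] := part_exists (clopen_fibers_comp (fun w : 'I_n * 'I_n * 'I_n => w.1.1) Zc).
  by move=> i; have [j [l /ex[x Zx]]] := Wi i; exists x; rewrite /= Zx.
have [|Q0 Q0E] := part_exists (clopen_fibers_comp (fun w : 'I_n * 'I_n * 'I_n => w.1.2) Zc).
  by move=> j; have [i [l /ex[x Zx]]] := Wj j; exists x; rewrite /= Zx.
have [|R0 R0E] := part_exists (clopen_fibers_comp (fun w : 'I_n * 'I_n * 'I_n => w.2) Zc).
  by move=> l; have [i [j /ex[x Zx]]] := Wl l; exists x; rewrite /= Zx.
have patE (A B : part n) al be : (forall x, label A x = al (Z x)) ->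
    (forall x, label B x = be (Z x)) -> pattern A B = [set (al w, be w) | w in W].
  move=> AE BE; apply/seteqP; split=> [_ [x _ <-]|_ [w /ex[x <-] <-]].
    by exists (Z x); rewrite ?AE ?BE // -ZW; exists x.
  by exists x; rewrite ?AE ?BE.
apply: (@same_pattern _ _ _ P0 R0); first by rewrite PR; exact: patE.
by rewrite (W12 P0 Q0) ?(W23 Q0 R0) //; exact: patE.
Qed.

(** No partition with fewer parts maps to S. *)
Definition minimal_cover n (S : gset X) (q : gmap (part n) S) :=
  forall m, (0 < m < n)%N -> gmap (part m) S -> False.

(** Otherwise a part c of Q meets two parts a and b of P. Composing the pattern
    of (P, Q) with its transpose shows that q identifies any two partitions whose
    pattern relates all labels with the same image under the gluing r of a and b;
    composing once more, q identifies any two partitions that agree after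
    gluing, and factors through fewer parts. *)
Lemma minimal_refines n (S : gset X) (q : gmap (part n) S) (P Q : part n) x y :
  minimal_cover q -> q P = q Q -> label Q x = label Q y -> label P x = label P y.
Proof.
move=> min PQ Qxy; apply: contrapT => /eqP.
case: n q min P Q PQ Qxy => [|[|k]] q min P Q PQ Qxy.
- by have := ltn_ord (label P x).
- by rewrite !ord1 eqxx.
set a := label P x; set b := label P y => ab.
have [r rs rab] := merge_pair ab; have ker := split_kernel rs ab rab.
pose E : set ('I_k.+2 * 'I_k.+2) := [set uv | r uv.1 = r uv.2].
pose c := label Q x.
have EP P' R' : pattern P' R' = E -> q P' = q R'.
  pose W : set ('I_k.+2 * 'I_k.+2 * 'I_k.+2) :=
    (* As few triples as possible: returning to the first label, except through c. *)
    [set w | [\/ pattern P Q (w.1.1, w.1.2) /\ w.2 = w.1.1, w = (a, c, b) | w = (b, c, a)]].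
  have Wdiag z : W (label P z, label Q z, label P z) by constructor 1; split=> //; exists z.
  move=> PE; apply: (@compose_patterns _ _ _ W).
  - move=> P1 Q1 P1Q1; apply: same_pattern PQ; rewrite P1Q1.
    apply/seteqP; split=> [_ [z _ <-]|_ [w [[wPQ _]|->|->] <-]] //=.
    + by exists (label P z, label Q z, label P z).
    + by exists x.
    + by exists y; rewrite // -Qxy.
  - move=> P1 Q1 P1Q1; apply: same_pattern (esym PQ); rewrite P1Q1.
    apply/seteqP; split=> [_ [z _ <-]|_ [w [[[z _ [zP zQ]] ->]|->|->] <-]] //=.
    + by exists (label P z, label Q z, label P z).
    + by exists z => //; rewrite zP zQ.
    + by exists y; rewrite // -Qxy.
    + by exists x.
  - by move=> i; have [z <-] := label_onto P i; exists (label Q z), (label P z).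
  - by move=> i; have [z <-] := label_onto Q i; exists (label P z), (label P z).
  - by move=> i; have [z <-] := label_onto P i; exists (label P z), (label Q z).
  - rewrite PE; apply/seteqP; split=> [[u v]|_ [w [[_ w2]|->|->] <-]].
    + rewrite /E /= => /ker[->|[-> ->]|[-> ->]].
      * by have [z <-] := label_onto P v; exists (label P z, label Q z, label P z).
      * by exists (a, c, b) => //; constructor 2.
      * by exists (b, c, a) => //; constructor 3.
    + by rewrite /E /= w2.
    + by rewrite /E /= rab.
    + by rewrite /E /= rab.
have Ecoarse P' R' : (forall z, r (label P' z) = r (label R' z)) -> q P' = q R'.
  move=> PR; pose W : set ('I_k.+2 * 'I_k.+2 * 'I_k.+2) :=
    [set w | [/\ pattern P' R' (w.1.1, w.2), r w.1.1 = r w.1.2 & r w.1.2 = r w.2]].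
  have Wdiag z : W (label P' z, label P' z, label R' z) by split=> //; [exists z|rewrite /= PR].
  apply: (@compose_patterns _ _ _ W).
  - move=> P1 Q1 P1Q1; apply: EP; rewrite P1Q1.
    apply/seteqP; split=> [_ [w [_ ? _] <-] //|[u v] /= uv].
    have [z zu] := label_onto P' u; exists (u, v, label R' z) => //; split=> //=.
      by rewrite -zu; exists z.
    by rewrite -uv -zu PR.
  - move=> P1 Q1 P1Q1; apply: EP; rewrite P1Q1.
    apply/seteqP; split=> [_ [w [_ _ ?] <-] //|[u v] /= uv].
    have [z zv] := label_onto R' v; exists (label P' z, u, v) => //; split=> //=.
      by rewrite -zv; exists z.
    by rewrite uv -zv PR.
  - by move=> i; have [z <-] := label_onto P' i; exists (label P' z), (label R' z).
  - by move=> i; have [z <-] := label_onto P' i; exists (label P' z), (label R' z).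
  - by move=> i; have [z <-] := label_onto R' i; exists (label P' z), (label P' z).
  - apply/seteqP; split=> [_ [z _ <-]|_ [w [wPR _ _] <-] //].
    by exists (label P' z, label P' z, label R' z).
have [R0 _] := part_inhabited cX (ltn0Sn k.+1).
have rel_onto := gmap_surj (relabel X rs) R0 (part_gtransitive cX (ltn0Sn k)).
have [|h _] := @gmap_factor X _ _ _ (relabel X rs) q rel_onto.
  move=> P' R' e; apply: Ecoarse => z.
  by rewrite -!(relabelE rs) e.
by apply: (min k.+1) h; rewrite ltnS leqnn.
Qed.

Lemma minimal_quotient n (S : gset X) (q : gmap (part n) S) :
  (0 < n)%N -> gtransitive S -> minimal_cover q -> exists G : {group 'S_n}, quot_by q G.
Proof.
move=> n0 Str qmin; have [P0 _] := part_inhabited cX n0.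
pose G := [set s : 'S_n | `[< q (pperm X s P0) = q P0 >]]%SET.
have GP s P : s \in G <-> q (pperm X s P) = q P.
  have [g <-] := part_transitive cX P0 P; rewrite inE !gfunM.
  split=> [/asboolP -> //|/(congr1 (gact (g^-1)%g))]; rewrite !gactK => e.
  exact/asboolP.
have Ggrp : group_set G.
  apply/group_setP; split; first by apply/(GP _ P0); rewrite pperm1.
  by move=> s t /(GP _ P0) sG /(GP _ (pperm X s P0)) tG; apply/(GP _ P0); rewrite ppermM tG.
exists (Group Ggrp); split; first exact: gmap_surj P0 Str.
move=> P Q; split=> [PQ|[s /GP sG ->]]; last by rewrite sG.
have [s sE] := onto_factor (label_onto P)
  (fun x y => minimal_refines qmin (esym PQ) (x := x) (y := y)).
have so : onto s by move=> j; have [x <-] := label_onto Q j; exists (label P x).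
have QE : Q = pperm X (perm (onto_inj so)) P.
  by apply: partP => x; rewrite relabelE permE sE.
by exists (perm (onto_inj so)) => //; apply/(GP _ P); rewrite -QE.
Qed.

Lemma minimal_cover_ex (S : gset X) : gtransitive S ->
  exists n (q : gmap (part n) S), (0 < n)%N /\ minimal_cover q.
Proof.
move=> Str; have [n [h [n0 _]]] := part_cover Str.
elim/ltn_ind: n n0 h => n IHn n0 h.
have [|nmin] := pselect (minimal_cover h); first by exists n, h.
have [m [/andP[m0 mn] [k _]]] : exists m, (0 < m < n)%N /\ exists k : gmap (part m) S, True.
  by apply: contrapT => nex; apply: nmin => m mn k; apply: nex; exists m; split=> //; exists k.
exact: IHn mn m0 k.
Qed.

(** The target is replaced by some X(n) through base change, then the source by
    its orbits, which are quotients of sets of partitions by groups of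
    permutations. *)
Theorem is_rational_tclass (S T : fgset X) (f : gmap S T) tT :
  is_rational cX (tclass f tT).
Proof.
have K0 : is_rational cX 0 by exact: (is_rational_int cX 0).
apply: tclass_orbits => // [x y|A Atr]; first exact: is_rationalD.
rewrite /tclass_on; move: (gcomp f (sub_incl A) : gmap (subF A) T) => {}f.
move: (subF A) Atr f => {A}{}S Str f.
have [n [h [n0 hs]]] := part_cover tT.
have [m [q [m0 qs]]] := part_cover Str.
pose F := FGSet (fiber_finitary f h qs).
have tn : gtransitive (partF n) := part_gtransitive cX n0.
rewrite -(@tclass_base_change X S T F (partF n) f h (fib2 f h) (fib1 f h) tT tn
  (fib_cartesian f h)).
move: (fib2 f h : gmap F (partF n)); move: F => {S Str f q qs T tT h hs m m0}S f.
apply: tclass_orbits => // [x y|A Atr]; first exact: is_rationalD.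
rewrite /tclass_on; move: (gcomp f (sub_incl A) : gmap (subF A) (partF n)) => {}f.
move: (subF A) Atr f => {A}{}S Str f.
have [m [q [m0 qmin]]] := minimal_cover_ex Str.
have [G [qs qG]] := minimal_quotient m0 Str qmin.
have [p [ps pE]] := gmap_parts (gcomp f q) m0.
have Gp : G \subset fixg p.
  apply/fintype.subsetP => s sG; apply/fixgP => i; have [P _] := part_inhabited cX m0.
  have [x <-] := label_onto P i; rewrite -(relabelE (perm_surj s)) -!pE /=.
  by congr (label (f _) x); apply/esym/qG; exists s.
have <- : quot_class G p = tclass f tn by apply: quot_classE; exists S, q, f, tn.
rewrite (@quot_class_index _ cX _ _ p G (fixg_group p)) //.
by apply: is_rationalM; [exact: is_rational_nat|exact: is_rational_fixg].
Qed.

End Classification.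

(** * Inverses of integers *)

Section Translations.
Variable k : nat.

Definition translation (a : 'I_k.+1) : 'S_k.+1 := perm (@addrI _ a).

Lemma translation_group_set : group_set [set translation a | a : 'I_k.+1]%SET.
Proof.
apply/group_setP; split.
  by apply/imsetP; exists 0 => //; apply/permP => x; rewrite perm1 permE add0r.
move=> _ _ /imsetP[a _ ->] /imsetP[b _ ->]; apply/imsetP; exists (b + a) => //.
by apply/permP => x; rewrite permM !permE addrA.
Qed.

(** A regular cyclic group of permutations, of order the number of labels. *)
Definition translation_group : {group 'S_k.+1} := Group translation_group_set.

Lemma card_translation : #|translation_group| = k.+1.
Proof.
rewrite card_imset ?card_ord // => a b /permP/(_ 0).
by rewrite !permE !addr0.
Qed.

End Translations.

Section Inverses.
Variables (X : top_space) (cX : is_cantor X).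
Notation part := (surj_gset X).
Notation partF n := (surj_fgset n cX).
Notation quot_class := (quot_class cX).
Notation p := (splitting cX).
Notation e := (nu_idem cX).

Lemma quot_class_point k (r : 'I_k.+1 -> 'I_1) : quot_class 1%g r = p ^+ k.
Proof.
have onto1 j (f : 'I_j.+1 -> 'I_1) : onto f by move=> i; exists ord0; rewrite !ord1.
elim: k r => [|k IHk] r; first by rewrite quot_class_inj // => x y _; rewrite !ord1.
have -> : r = (fun=> ord0) \o ext (ord0 : 'I_k.+1) by apply/funext => i; rewrite !ord1.
rewrite quot_class_comp //; last exact: ext_onto.
by rewrite IHk -/(split_class cX k) split_classE exprSr.
Qed.

(** X(k+1) -> X(1) factors through the quotient by a group of order k+1. *)
Lemma natural_divides k : exists u, k.+1%:R * u = p ^+ k.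
Proof.
pose r : 'I_k.+1 -> 'I_1 := fun=> ord0.
have rs : onto r by move=> i; exists ord0; rewrite !ord1.
exists (quot_class (translation_group k) r); rewrite -(quot_class_point r).
rewrite (@quot_class_index _ cX _ _ r 1%G (translation_group k)) ?sub1G //.
  by rewrite indexg1 card_translation.
by apply/fintype.subsetP => s _; apply/fixgP => i.
Qed.

Lemma nu_idemN : (1 - e) * e = 0.
Proof. by rewrite mulrBl mul1r nu_idemM subrr. Qed.

Lemma nu_idem_splitting k : e * p ^+ k = (-1) ^+ k * e.
Proof.
elim: k => [|k IHk]; first by rewrite !expr0 mulr1 mul1r.
have ep : e * p = - e.
  transitivity (e * e - 2 * e); first by rewrite /nu_idem; ring.
  by rewrite nu_idemM; ring.
by rewrite exprSr mulrA IHk -mulrA ep exprSr; ring.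
Qed.

Lemma mu_idem_splitting k : (1 - e) * p ^+ k = (-2) ^+ k * (1 - e).
Proof.
elim: k => [|k IHk]; first by rewrite !expr0 mulr1 mul1r.
have ep : (1 - e) * p = -2 * (1 - e).
  transitivity ((1 - e) * e - 2 * (1 - e)); first by rewrite /nu_idem; ring.
  by rewrite nu_idemN; ring.
by rewrite exprSr mulrA IHk -mulrA ep exprSr; ring.
Qed.

Lemma pos_invertible n : (0 < n)%N -> exists y, n%:R * y * e = e.
Proof.
case: n => // k _; have [u uE] := natural_divides k.
exists (u * (-1) ^+ k); transitivity ((k.+1%:R * u) * e * (-1) ^+ k); first by ring.
rewrite uE [p ^+ k * e]mulrC nu_idem_splitting mulrAC -exprMn_comm; last exact: commr_refl.
by rewrite mulrNN mulr1 expr1n mul1r.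
Qed.

(** On this component n divides a power of -2, and an odd n is coprime to it. *)
Lemma odd_invertible n : odd n -> exists y, n%:R * y * (1 - e) = 1 - e.
Proof.
case: n => // k on; have [u uE] := natural_divides k.
have cop : coprimez k.+1%:Z ((-2) ^+ k).
  rewrite coprimezE abszX /=; apply: coprimeXr.
  by rewrite coprime_sym coprime2n.
(* The inverse comes from a Bezout relation a (k + 1) + b (-2) ^ k = 1. *)
have [[a b] /= ab] := coprimezP _ _ cop.
exists (a%:~R + b%:~R * u).
transitivity (a%:~R * k.+1%:R * (1 - e) + b%:~R * ((1 - e) * (k.+1%:R * u))); first by ring.
rewrite uE mu_idem_splitting mulrA -mulrDl.
rewrite (_ : _ + _ = (a * k.+1%:Z + b * (-2) ^+ k)%:~R); first by rewrite ab mul1r.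
by rewrite rmorphD !rmorphM rmorphXn.
Qed.

(** X(1) is a point, so nothing is lost by base change from the one-point set. *)
Lemma splitting_surj2 : p = theta_class (tmap_one (partF 2)).
Proof.
rewrite -(split_classE cX 0) /split_class (quot_class1E cX (ext_onto (ord0 : 'I_1)) (ltn0Sn 0)).
apply: (@tclass_base_change X (partF 2) (gone X) (partF 2) (partF 1) (gto_one (partF 2))
  (gto_one (partF 1)) _ (gid _)); split=> // P Q _.
exists P; split=> [|P' [] //]; split=> //.
by apply: partP => x; rewrite !ord1.
Qed.

End Inverses.

(** * Measures as ring homomorphisms *)

Section Evaluation.
Variables (X : top_space) (k : comPzRingType) (mu : tmap X -> k).
Hypothesis mu_measure : is_measure mu.

Fixpoint eval (t : rterm (tmap X)) : k :=
  match t with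
  | RGen f => mu f
  | RZero => 0
  | ROne => 1
  | ROpp a => - eval a
  | RAdd a b => eval a + eval b
  | RMul a b => eval a * eval b
  end.

Lemma eval_congr a b : rcongr (@theta_rel X) a b -> eval a = eval b.
Proof.
elim=> {a b} //=.
- move=> _ _ []; [exact: measure_iso|exact: measure_add|exact: measure_comp|].
  exact: measure_base_change.
- by move=> a b c _ -> _ ->.
- by move=> a b _ ->.
- by move=> a b c d _ -> _ ->.
- by move=> a b c d _ -> _ ->.
- by move=> a b c; rewrite addrA.
- by move=> a b; rewrite addrC.
- by move=> a; rewrite add0r.
- by move=> a; rewrite addNr.
- by move=> a b c; rewrite mulrA.
- by move=> a b; rewrite mulrC.
- by move=> a; rewrite mul1r.
- by move=> a b c; rewrite mulrDl.
Qed.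

Lemma measure_rmorphism : exists phi : {rmorphism Theta X -> k},
  forall f, phi (theta_class f) = mu f.
Proof.
pose phi (x : Theta X) : k := eval (generic_quotient.repr x).
pose cls := pcls (@theta_rel X) : _ -> Theta X.
have phiE a : phi (cls a) = eval a by apply: eval_congr; exact: repr_pcls.
have clsK (x : Theta X) : exists a, x = cls a.
  by exists (generic_quotient.repr x); rewrite /cls pclsK.
have phiB : zmod_morphism phi.
  move=> x y; have [a ->] := clsK x; have [b ->] := clsK y.
  have -> : cls a - cls b = cls (RAdd a (ROpp b)).
    by rewrite /cls -paddE -poppE.
  by rewrite !phiE.
have phiM : monoid_morphism phi.
  split=> [|x y]; first exact: (phiE (ROne _)).
  have [a ->] := clsK x; have [b ->] := clsK y.
  have -> : cls a * cls b = cls (RMul a b) by rewrite /cls -pmulE.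
  by rewrite !phiE.
pose B1 := GRing.isZmodMorphism.Build (Theta X) k phi phiB.
pose B2 := GRing.isMonoidMorphism.Build (Theta X) k phi phiM.
pose psi : {rmorphism Theta X -> k} := HB.pack phi B1 B2.
by exists psi => f; exact: phiE.
Qed.

End Evaluation.

Lemma Theta_ind (X : top_space) (K : Theta X -> Prop) :
  (forall f, K (theta_class f)) -> K 0 -> K 1 -> (forall x, K x -> K (- x)) ->
  (forall x y, K x -> K y -> K (x + y)) -> (forall x y, K x -> K y -> K (x * y)) ->
  forall x, K x.
Proof.
move=> Kf K0 K1 KN KD KM x; rewrite -(pclsK x).
elim: (generic_quotient.repr x) => {x} [f|||a Ka|a Ka b Kb|a Ka b Kb].
- exact: Kf.
- exact: K0.
- exact: K1.
- by rewrite -poppE; exact: KN.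
- by rewrite -paddE; exact: KD.
- by rewrite -pmulE; exact: KM.
Qed.

(** * The isomorphism *)

Lemma Z_2locP (r : rat) (a : nat) (c : int) : odd a -> a%:R * r = c%:~R -> Z_2loc r.
Proof.
move=> oa arc; rewrite /Z_2loc /=; apply: dvdn_odd oa.
have E : (a%:Z * numq r = c * denq r)%R.
  apply: (@intr_inj rat); rewrite !rmorphM /= -arc.
  by rewrite -{1}(divq_num_den r) -[RHS]mulrA divq_num_den -numqE.
have : (denq r %| a%:Z * numq r)%Z by rewrite E dvdz_mull.
by rewrite Gauss_dvdzl // coprimez_sym coprimezE coprime_num_den.
Qed.

Theorem theorem4p5 (X : top_space) (cX : is_cantor X) (mu nu : tmap X -> rat)
    (mu_measure : is_measure mu) (nu_measure : is_measure nu)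
    (mu_regular : regular mu) (nu_regular : regular nu)
    (mu_surj : forall n : nat, (1 <= n)%N ->
      mu (tmap_one (surj_fgset n cX)) = (- 2) ^+ n.-1)
    (nu_surj : forall n : nat, (1 <= n)%N ->
      nu (tmap_one (surj_fgset n cX)) = (- 1) ^+ n.-1) :
  exists phi : {rmorphism Theta X -> (rat * rat)%type},
    [/\ forall f : tmap X, phi (theta_class f) = (mu f, nu f),
        injective phi
      & range phi = Z_2loc `*` [set: rat]].
Proof.
have meas : @is_measure X (rat * rat)%type (fun f => (mu f, nu f)).
  split.
  - by move=> S T p tT pi; rewrite (measure_iso mu_measure) // (measure_iso nu_measure).
  - move=> S1 S2 S T i1 i2 p tT dec.
    by rewrite (measure_add mu_measure _ _ dec) (measure_add nu_measure _ _ dec).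
  - move=> S T U p q tT tU.
    by rewrite (measure_comp mu_measure _ _ tT) (measure_comp nu_measure _ _ tT).
  - move=> S T S' T' p q p' q' tT tT' c.
    rewrite (measure_base_change mu_measure _ tT' c).
    by rewrite (measure_base_change nu_measure _ tT' c).
have [phi phiE] := measure_rmorphism meas; exists phi.
have [f1 f1E] : exists f : {rmorphism Theta X -> rat}, forall x, f x = (phi x).1.
  by exists (fst \o phi).
have [f2 f2E] : exists f : {rmorphism Theta X -> rat}, forall x, f x = (phi x).2.
  by exists (snd \o phi).
have f1p : f1 (splitting cX) = -2.
  by rewrite splitting_surj2 f1E phiE /= mu_surj.
have f2p : f2 (splitting cX) = -1.
  by rewrite splitting_surj2 f2E phiE /= nu_surj.
have f1e : f1 (nu_idem cX) = 0 by rewrite /nu_idem rmorphD f1p rmorph_nat.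
have f2e : f2 (nu_idem cX) = 1 by rewrite /nu_idem rmorphD f2p rmorph_nat.
have f1e' : f1 (1 - nu_idem cX) = 1 by rewrite rmorphB rmorph1 f1e subr0.
have rat_all x : is_rational cX x.
  elim/Theta_ind: x => [[S T f tT]|||x|x y|x y].
  - exact: (is_rational_tclass cX f tT).
  - exact: (is_rational_int cX 0).
  - exact: (is_rational_int cX 1).
  - by rewrite -mulN1r; apply: is_rationalM; exact: (is_rational_int cX (-1)).
  - exact: is_rationalD.
  - exact: is_rationalM.
have f1odd x : exists a (c : int), odd a /\ a%:R * f1 x = c%:~R /\
    (1 - nu_idem cX) * (a%:R * x) = (1 - nu_idem cX) * c%:~R.
  have [[a [c [oa ac]]] _] := rat_all x; exists a, c; split=> //; split=> //.
  by have /(congr1 f1) := ac; rewrite !rmorphM f1e' !mul1r rmorph_nat rmorph_int.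
have f2pos x : exists b (d : int), (0 < b)%N /\ b%:R * f2 x = d%:~R /\
    nu_idem cX * (b%:R * x) = nu_idem cX * d%:~R.
  have [_ [b [d [b0 bd]]]] := rat_all x; exists b, d; split=> //; split=> //.
  by have /(congr1 f2) := bd; rewrite !rmorphM f2e !mul1r rmorph_nat rmorph_int.
split; first exact: phiE.
- move=> x y xy; apply/eqP; rewrite -subr_eq0; apply/eqP; set z := x - y.
  have z1 : f1 z = 0 by rewrite rmorphB !f1E xy subrr.
  have z2 : f2 z = 0 by rewrite rmorphB !f2E xy subrr.
  have e'z : (1 - nu_idem cX) * z = 0.
    have [a [c [oa [ac]]]] := f1odd z; move: ac; rewrite z1 mulr0 => /esym/eqP.
    (* On this component a kills z, and a is invertible. *)
    rewrite intr_eq0 => /eqP -> az; have [v vE] := odd_invertible cX oa.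
    rewrite -vE; transitivity (v * ((1 - nu_idem cX) * (a%:R * z))); first by ring.
    by rewrite az !mulr0.
  have ez : nu_idem cX * z = 0.
    have [b [d [b0 [bd]]]] := f2pos z; move: bd; rewrite z2 mulr0 => /esym/eqP.
    rewrite intr_eq0 => /eqP -> bz; have [v vE] := pos_invertible cX b0.
    rewrite -vE; transitivity (v * (nu_idem cX * (b%:R * z))); first by ring.
    by rewrite bz !mulr0.
  by rewrite -[z]mul1r -(subrK (nu_idem cX) 1) mulrDl e'z ez addr0.
- apply/seteqP; split=> [_ [x _ <-]|[r s] [/= r2 _]].
    split=> //; have [a [c [oa [ac _]]]] := f1odd x.
    by apply: Z_2locP oa _; rewrite -f1E; exact: ac.
  have [v vE] := odd_invertible cX r2.
  have s0 : (0 < `|denq s|)%N by rewrite absz_gt0 denq_neq0.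
  have [w wE] := pos_invertible cX s0.
  have quotient_den (t y : rat) : `|denq t|%N%:R * y = 1 -> (numq t)%:~R * y = t.
    rewrite pmulrn absz_denq => ty.
    have t0 : (denq t)%:~R != 0 :> rat by rewrite intr_eq0 denq_neq0.
    by apply: (mulfI t0); rewrite mulrCA ty mulr1 mulrC -numqE.
  have f1v : (numq r)%:~R * f1 v = r.
    by apply: quotient_den; have /(congr1 f1) := vE; rewrite !rmorphM f1e' mulr1 rmorph_nat.
  have f2w : (numq s)%:~R * f2 w = s.
    by apply: quotient_den; have /(congr1 f2) := wE; rewrite !rmorphM f2e mulr1 rmorph_nat.
  exists ((1 - nu_idem cX) * ((numq r)%:~R * v) + nu_idem cX * ((numq s)%:~R * w)) => //.
  rewrite [LHS]surjective_pairing -f1E -f2E; congr (_, _).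
    by rewrite rmorphD !rmorphM f1e' f1e mul0r addr0 mul1r rmorph_int.
  by rewrite rmorphD !rmorphM rmorphB rmorph1 f2e subrr mul0r add0r mul1r rmorph_int.
Qed.
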